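(* Let $G$ be a non-elementary subgroup of $PU(1,n;\mathbb{C})$, let $h\in G$ be a loxodromic element with fixed points $x_0\neq y_0$, and let $G(x_0,y_0)=\{f\in G:\{x_0,y_0\}\subset\mathrm{fix}(f)\}$. Then $G$ is discrete if and only if (1) $G(x_0,y_0)$ satisfies Condition A, and (2) every subgroup of $G$ generated by two loxodromic elements of $G$ is discrete.
   Context: $PU(1,n;\mathbb{C})$ ($n\ge 1$) is the projectivized group of linear automorphisms of $\mathbb{C}^{n+1}$ preserving a Hermitian form of signature $(1,n)$; it acts by holomorphic isometries on complex hyperbolic space $H^n_{\mathbb{C}}$ and continuously on its closure $\overline{H^n_{\mathbb{C}}}=H^n_{\mathbb{C}}\cup\partial H^n_{\mathbb{C}}$. It carries the topology induced from the matrix group; a subgroup is discrete if it is discrete in this topology, and $I$ denotes the identity. A non-trivial element $g$ is elliptic if it has a fixed point in $H^n_{\mathbb{C}}$; parabolic if it has exactly one fixed point in $\overline{H^n_{\mathbb{C}}}$ and it lies on $\partial H^n_{\mathbb{C}}$; loxodromic if it has exactly two fixed points in $\overline{H^n_{\mathbb{C}}}$ and both lie on $\partial H^n_{\mathbb{C}}$. A subgroup is non-elementary if it contains two non-elliptic elements of infinite order with distinct fixed points. For $g$, $\mathrm{fix}(g)=\{x\in\partial H^n_{\mathbb{C}}: g(x)=x\}$. A subgroup $H$ satisfies Condition A if there is no sequence $\{g_i\}$ of distinct elements of $H$ of finite order with $\mathrm{Card}(\mathrm{fix}(g_i))=\infty$ for all $i$ and $g_i\to I$. *)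

(* Defs.v *)
From HB Require Import structures.
From mathcomp Require Import all_boot all_order all_algebra.
From mathcomp Require Import complex Rstruct.
Set Implicit Arguments. Unset Strict Implicit. Unset Printing Implicit Defensive.
Import Order.TTheory GRing.Theory Num.Theory.
Local Open Scope ring_scope.

Notation C := (Rdefinitions.R[i]).

Section PU.
Variable n : nat.

Notation mat := 'M[C]_(n.+1).
Notation vec := 'cV[C]_(n.+1).

(* Hermitian form of signature (1,n) on C^{n+1}:
   <z,w> = z_0 conj(w_0) - sum_{k>=1} z_k conj(w_k) = w^* J z *)
Definition Jmx : mat :=
  \matrix_(i, j) (if i == j then (if i == ord0 then 1 else -1) else 0).

Definition adjm (p q : nat) (A : 'M[C]_(p, q)) : 'M[C]_(q, p) :=
  (map_mx Num.conj A)^T.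

Definition herm (z w : vec) : C := (adjm w *m Jmx *m z) 0 0.

Definition inU (A : mat) : Prop := adjm A *m Jmx *m A = Jmx.

(* Elements of PU(1,n) are represented by matrices of U(1,n); two
   representatives give the same element of PU(1,n) iff they differ by a
   unit scalar. *)
Definition proj_eq (A B : mat) : Prop :=
  exists lam : C, `|lam| = 1 /\ B = lam *: A.

Definition is_id (A : mat) : Prop := proj_eq 1%:M A.

(* B lies in the eps-ball around A for the quotient metric
   d([A],[B]) = inf_{|lam|=1} max_{i,j} |lam A_ij - B_ij|, which induces the
   quotient (= matrix-group) topology on PU(1,n). *)
Definition pu_near (A B : mat) (eps : Rdefinitions.R) : Prop :=
  exists lam : C, `|lam| = 1 /\
    forall i j, `|lam * A i j - B i j| < (eps%:C)%C.

Definition pu_cvg (g : nat -> mat) (B : mat) : Prop :=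
  forall eps : Rdefinitions.R, 0 < eps ->
    exists N, forall k, (N <= k)%N -> pu_near (g k) B eps.

Definition pu_discrete (S : mat -> Prop) : Prop :=
  forall A, S A -> exists2 eps : Rdefinitions.R, 0 < eps &
    forall B, S B -> pu_near A B eps -> proj_eq A B.

(* subgroups of PU(1,n): images of subgroups of U(1,n) *)
Definition PUsubgroup (G : mat -> Prop) : Prop :=
  [/\ G 1%:M, (forall A, G A -> inU A),
      (forall A B, G A -> G B -> G (A *m B)) &
      (forall A, G A -> G (invmx A))].

Inductive gen2 (A B : mat) : mat -> Prop :=
| gen2_1 : gen2 A B 1%:M
| gen2_A : gen2 A B A
| gen2_B : gen2 A B B
| gen2_mul X Y : gen2 A B X -> gen2 A B Y -> gen2 A B (X *m Y)
| gen2_inv X : gen2 A B X -> gen2 A B (invmx X).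

(* points: a nonzero vector v represents the line [v];
   H^n_C = positive lines, boundary = null lines, closure = both. *)
Definition pos_vec (v : vec) : Prop := 0 < herm v v.
Definition null_vec (v : vec) : Prop := v != 0 /\ herm v v = 0.
Definition closure_vec (v : vec) : Prop := v != 0 /\ 0 <= herm v v.

(* [v] = [w] as points (for nonzero v, w) *)
Definition proportional (v w : vec) : Prop := exists mu : C, w = mu *: v.

Definition fixes (A : mat) (v : vec) : Prop := exists mu : C, A *m v = mu *: v.

Definition bfix (A : mat) (v : vec) : Prop := null_vec v /\ fixes A v.

Definition elliptic (A : mat) : Prop :=
  ~ is_id A /\ exists v, pos_vec v /\ fixes A v.

Definition parabolic (A : mat) : Prop :=
  ~ is_id A /\ exists v, [/\ null_vec v, fixes A v &
    forall w, closure_vec w -> fixes A w -> proportional v w].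

Definition loxodromic (A : mat) : Prop :=
  ~ is_id A /\ exists v w,
    null_vec v /\ null_vec w /\ fixes A v /\ fixes A w /\
    ~ proportional v w /\
    (forall u, closure_vec u -> fixes A u ->
       proportional v u \/ proportional w u).

Definition finite_order (A : mat) : Prop :=
  exists k : nat, (0 < k)%N /\ is_id (A ^+ k).

Definition infinite_bfix (A : mat) : Prop :=
  forall s : seq vec, exists v, bfix A v /\
    forall w, w \in s -> ~ proportional w v.

Definition nonelementary (G : mat -> Prop) : Prop :=
  exists A B, G A /\ G B /\ ~ elliptic A /\ ~ elliptic B /\
    ~ finite_order A /\ ~ finite_order B /\
    ~ (exists v, bfix A v /\ bfix B v).

Definition stab2 (G : mat -> Prop) (x0 y0 : vec) : mat -> Prop :=
  fun f => [/\ G f, fixes f x0 & fixes f y0].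

Definition conditionA (H : mat -> Prop) : Prop :=
  ~ exists g : nat -> mat,
      [/\ forall i, H (g i),
          forall i j, i <> j -> ~ proj_eq (g i) (g j),
          forall i, finite_order (g i),
          forall i, infinite_bfix (g i) &
          pu_cvg g 1%:M].

End PU.

(* Main.v *)
(* Suppose that G is not discrete and take g in G near the identity.  Both h and
   f = g h g^-1 are loxodromic, so <h, f> is discrete, and it contains f h^-1,
   which is near the identity.  If f h^-1 is nontrivial, halving norms as long as
   possible gives a nontrivial k in <h, f> near the identity that commutes with
   all elements of <h, f> in a fixed neighbourhood of 1, because commutators
   contract there (Zassenhaus).  In particular the conjugates h^j k h^-j with
   0 <= j <= n+2 commute and have a common eigenvector v of nonnegative norm.
   Unless v is on the axis of h, at least three of the points h^-j v are fixed
   by k, so they lie in one eigenspace of k; by Cayley-Hamilton all the h^-j v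
   do, hence so does their limit, and k fixes an end point of h.  Discreteness
   then forces k to fix both.  The same applies to f, so k fixes x0, y0, g x0 and
   g y0.  An element of G near the identity that fixes three boundary points
   acts as a scalar on their span, has infinitely many boundary fixed points, and
   has finite order because it lies in a discrete group <h, g h>; Condition A
   excludes it.  Hence g fixes x0 and y0.  As G is non-elementary, some A in G
   moves the axis of h, and A^-1 g A also fixes x0 and y0, so g fixes a third
   point and Condition A makes it trivial. *)
From Stdlib Require Import Classical IndefiniteDescription.
Require Import Defs.
From HB Require Import structures.
From mathcomp Require Import all_boot all_order all_algebra.
From mathcomp Require Import complex Rstruct.
From mathcomp Require Import ring lra spectral.
Import Order.TTheory GRing.Theory Num.Theory.
Local Open Scope ring_scope.
Set Implicit Arguments. Unset Strict Implicit. Unset Printing Implicit Defensive.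

Local Notation R := Rdefinitions.R.

(** * Complex absolute values and matrix norms *)

(** The norm on [C] takes values in [C]; a real-valued copy lets [lra] and [nra] work on
    estimates. *)
Definition cabs (x : C) : R := complex.Re `|x|.

Lemma cabsE (x : C) : `|x| = (cabs x)%:C%C.
Proof. by rewrite /cabs RRe_real // normr_real. Qed.

Lemma cabs_ge0 (x : C) : 0 <= cabs x.
Proof. by have := normr_ge0 x; rewrite cabsE lecR. Qed.

Lemma cabsM (x y : C) : cabs (x * y) = cabs x * cabs y.
Proof. by apply: complexI; rewrite rmorphM -!cabsE normrM. Qed.

Lemma cabs0 : cabs 0 = 0.
Proof. by apply: complexI; rewrite -cabsE normr0. Qed.

Lemma cabs1 : cabs 1 = 1.
Proof. by apply: complexI; rewrite -cabsE normr1. Qed.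

Lemma cabsX (x : C) m : cabs (x ^+ m) = cabs x ^+ m.
Proof. by apply: complexI; rewrite rmorphXn /= -!cabsE normrX. Qed.

Lemma cabsV (x : C) : cabs x^-1 = (cabs x)^-1.
Proof. by apply: complexI; rewrite fmorphV /= -!cabsE normfV. Qed.

Lemma cabsN (x : C) : cabs (- x) = cabs x.
Proof. by apply: complexI; rewrite -!cabsE normrN. Qed.

Lemma cabsJ (x : C) : cabs (Num.conj x) = cabs x.
Proof. by apply: complexI; rewrite -!cabsE norm_conjC. Qed.

Lemma cabsD (x y : C) : cabs (x + y) <= cabs x + cabs y.
Proof. by rewrite -lecR rmorphD /= -!cabsE ler_normD. Qed.

Lemma cabsB (x y : C) : cabs (x - y) = cabs (y - x).
Proof. by rewrite -cabsN opprB. Qed.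

Lemma cabs_eq0 (x : C) : (cabs x == 0) = (x == 0).
Proof. by rewrite -(inj_eq (@complexI R)) -cabsE normr_eq0. Qed.

Lemma cabs_gt0 (x : C) : (0 < cabs x) = (x != 0).
Proof. by rewrite lt_neqAle cabs_ge0 andbT eq_sym cabs_eq0. Qed.

Lemma cabs_sum (I : Type) (r : seq I) (P : pred I) (F : I -> C) :
  cabs (\sum_(i <- r | P i) F i) <= \sum_(i <- r | P i) cabs (F i).
Proof.
elim/big_rec2: _ => [|i y x _ IH]; first by rewrite cabs0.
by apply: le_trans (cabsD _ _) _; rewrite lerD2l.
Qed.

Lemma mul_conj (x : C) : x * Num.conj x = (cabs x ^+ 2)%:C%C.
Proof. by rewrite -normCK cabsE rmorphXn. Qed.

Lemma cabs_real (r : R) : 0 <= r -> cabs r%:C%C = r.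
Proof. by move=> h; apply: complexI; rewrite -cabsE ger0_norm // lecR. Qed.

Lemma norm1_cabs (x : C) : `|x| = 1 <-> cabs x = 1.
Proof. by split=> [h|h]; [apply: complexI; rewrite -cabsE h | rewrite cabsE h]. Qed.

Lemma sum_sqr_CS (I : finType) (a b : I -> R) :
  (\sum_i a i * b i) ^+ 2 <= (\sum_i a i ^+ 2) * (\sum_i b i ^+ 2).
Proof.
set A := \sum_i a i ^+ 2; set B := \sum_i b i ^+ 2; set D := \sum_i a i * b i.
have B0 : 0 <= B by apply: sumr_ge0 => i _; apply: sqr_ge0.
(* Multiplied by [B], the defect of the inequality is a sum of squares; [B = 0] is treated apart. *)
have key : 0 <= B * (A * B - D ^+ 2).
  have -> : B * (A * B - D ^+ 2) = \sum_i (B * a i - D * b i) ^+ 2.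
    rewrite (eq_bigr (fun i => B ^+ 2 * a i ^+ 2 + ((- (2 * B * D)) * (a i * b i)
       + D ^+ 2 * b i ^+ 2))); last by move=> i _; ring.
    rewrite big_split big_split /= -!mulr_sumr -/A -/B -/D; ring.
  by apply: sumr_ge0 => i _; apply: sqr_ge0.
have [B1|B1] := eqVneq B 0; last first.
  by rewrite -subr_ge0 -(pmulr_rge0 _ (_ : 0 < B)) // lt_neqAle eq_sym B1.
suff -> : D = 0 by rewrite B1 mulr0 expr0n.
apply: big1 => i _; move/eqP: B1; rewrite psumr_eq0; last by move=> *; apply: sqr_ge0.
by move=> /allP /(_ i); rewrite mem_index_enum sqrf_eq0 => /(_ isT)/eqP->; rewrite mulr0.
Qed.

(** The entrywise l1 norm is submultiplicative and unchanged by the adjoint and by [Jmx], so an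
    element of U(1,n) and its inverse have equal norm. *)
Definition nrm p q (A : 'M[C]_(p, q)) : R := \sum_i \sum_j cabs (A i j).

Section Nrm.
Variables p q r : nat.
Implicit Types A B : 'M[C]_(p, q).

Lemma nrm_ge0 A : 0 <= nrm A.
Proof. by apply: sumr_ge0 => i _; apply: sumr_ge0 => j _; apply: cabs_ge0. Qed.

Lemma nrm_entry A i j : cabs (A i j) <= nrm A.
Proof.
rewrite /nrm (bigD1 i) //= (bigD1 j) //= -addrA lerDl addr_ge0 //.
  by apply: sumr_ge0 => ? _; apply: cabs_ge0.
by apply: sumr_ge0 => ? _; apply: sumr_ge0 => ? _; apply: cabs_ge0.
Qed.

Lemma nrm_le_entry A (d : R) : (forall i j, cabs (A i j) <= d) -> nrm A <= (p * q)%:R * d.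
Proof.
move=> h; apply: le_trans (_ : \sum_(i < p) \sum_(j < q) d <= _).
  by apply: ler_sum => i _; apply: ler_sum.
by rewrite !sumr_const !card_ord -mulrnA mulr_natl mulnC.
Qed.

Lemma nrmD A B : nrm (A + B) <= nrm A + nrm B.
Proof.
rewrite /nrm -big_split /=; apply: ler_sum => i _; rewrite -big_split /=.
by apply: ler_sum => j _; rewrite mxE cabsD.
Qed.

Lemma nrmN A : nrm (- A) = nrm A.
Proof. by apply: eq_bigr => i _; apply: eq_bigr => j _; rewrite mxE cabsN. Qed.

Lemma nrmB A B : nrm (A - B) <= nrm A + nrm B.
Proof. by apply: le_trans (nrmD _ _) _; rewrite nrmN. Qed.

Lemma nrmZ a A : nrm (a *: A) = cabs a * nrm A.
Proof.
rewrite /nrm mulr_sumr; apply: eq_bigr => i _; rewrite mulr_sumr.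
by apply: eq_bigr => j _; rewrite mxE cabsM.
Qed.

Lemma nrm_eq0 A : nrm A = 0 -> A = 0.
Proof.
move=> h; apply/matrixP=> i j; apply/eqP; rewrite mxE -cabs_eq0.
by rewrite eq_le cabs_ge0 andbT -h nrm_entry.
Qed.

Lemma nrmM A (B : 'M[C]_(q, r)) : nrm (A *m B) <= nrm A * nrm B.
Proof.
rewrite {2}/nrm mulr_suml; apply: ler_sum => i _.
apply: le_trans (_ : \sum_k \sum_j cabs (A i j) * cabs (B j k) <= _).
  apply: ler_sum => k _; rewrite mxE; apply: le_trans (cabs_sum _ _ _) _.
  by under eq_bigr do rewrite cabsM.
rewrite exchange_big mulr_suml; apply: ler_sum => j _ /=.
rewrite -mulr_sumr ler_wpM2l ?cabs_ge0 // /nrm (bigD1 j) //= lerDl.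
by apply: sumr_ge0 => ? _; apply: sumr_ge0 => ? _; apply: cabs_ge0.
Qed.

End Nrm.

Lemma nrm_adjm p q (A : 'M[C]_(p, q)) : nrm (adjm A) = nrm A.
Proof.
by rewrite /nrm exchange_big; apply: eq_bigr => i _; apply: eq_bigr => j _;
  rewrite !mxE cabsJ.
Qed.

Lemma nrm1 n : nrm (1%:M : 'M[C]_n) = n%:R.
Proof.
rewrite /nrm -[RHS](_ : \sum_(i < n) 1 = _); last by rewrite sumr_const card_ord.
apply: eq_bigr => i _; rewrite (bigD1 i) //= big1 ?addr0 ?mxE ?eqxx ?cabs1 //.
by move=> j ij; rewrite mxE eq_sym (negbTE ij) cabs0.
Qed.

Lemma adjmM p q r (A : 'M[C]_(p, q)) (B : 'M[C]_(q, r)) :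
  adjm (A *m B) = adjm B *m adjm A.
Proof. by rewrite /adjm map_mxM trmx_mul. Qed.

Lemma adjmK p q (A : 'M[C]_(p, q)) : adjm (adjm A) = A.
Proof. by apply/matrixP=> i j; rewrite !mxE conjCK. Qed.

(** * The Hermitian form of signature (1,n) *)

Section Herm.
Variable n : nat.
Local Notation mat := 'M[C]_(n.+1).
Local Notation vec := 'cV[C]_(n.+1).
Implicit Types (A B : mat) (u v w z : vec) (a b : C).

Lemma adjm_Jmx : adjm (Jmx n) = Jmx n.
Proof.
apply/matrixP=> i j; rewrite !mxE eq_sym; case: eqP => [->|_]; last exact: rmorph0.
by case: ifP => _; rewrite ?rmorphN rmorph1.
Qed.

Lemma JmxJ : Jmx n *m Jmx n = 1%:M.
Proof.
apply/matrixP=> i j; rewrite !mxE (bigD1 i) //= big1 ?addr0.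
  rewrite !mxE eqxx; have [->|ij] := eqVneq i j; last by rewrite mulr0.
  by case: ifP => _; rewrite ?mulrNN mulr1.
by move=> k ki; rewrite mxE eq_sym (negbTE ki) mul0r.
Qed.

Lemma hermDl z1 z2 w : herm (z1 + z2) w = herm z1 w + herm z2 w.
Proof. by rewrite /herm mulmxDr mxE. Qed.

Lemma hermZl a z w : herm (a *: z) w = a * herm z w.
Proof. by rewrite /herm -scalemxAr mxE. Qed.

Lemma hermC z w : herm w z = Num.conj (herm z w).
Proof.
have -> : herm w z = (adjm (adjm w *m Jmx n *m z)) 0 0.
  by rewrite !adjmM adjmK adjm_Jmx mulmxA.
by rewrite /adjm mxE mxE.
Qed.

Lemma hermDr z w1 w2 : herm z (w1 + w2) = herm z w1 + herm z w2.
Proof. by rewrite hermC hermDl rmorphD /= -!hermC. Qed.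

Lemma hermZr a z w : herm z (a *: w) = Num.conj a * herm z w.
Proof. by rewrite hermC hermZl rmorphM /= -hermC. Qed.

Lemma hermNl z w : herm (- z) w = - herm z w.
Proof. by rewrite -scaleN1r hermZl mulN1r. Qed.

Lemma hermNr z w : herm z (- w) = - herm z w.
Proof. by rewrite -scaleN1r hermZr rmorphN rmorph1 mulN1r. Qed.

Lemma herm0l w : herm 0 w = 0.
Proof. by rewrite -(scale0r 0) hermZl mul0r. Qed.

Lemma herm_eq0C z w : herm z w = 0 -> herm w z = 0.
Proof. by move=> h; rewrite hermC h rmorph0. Qed.

Lemma hermU A z w : inU A -> herm (A *m z) (A *m w) = herm z w.
Proof.
move=> h; rewrite /herm adjmM.
have -> : adjm w *m adjm A *m Jmx n *m (A *m z) = adjm w *m (adjm A *m Jmx n *m A) *m z.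
  by rewrite !mulmxA.
by rewrite h.
Qed.

Lemma hermE z w : herm z w =
  z 0 0 * Num.conj (w 0 0) - \sum_(i < n) z (lift ord0 i) 0 * Num.conj (w (lift ord0 i) 0).
Proof.
rewrite /herm !mxE big_ord_recl; congr (_ + _).
  rewrite !mxE big_ord_recl big1 ?addr0; first by rewrite !mxE eqxx mulr1 mulrC.
  by move=> i _; rewrite !mxE /= mulr0.
rewrite -sumrN; apply: eq_bigr => i _.
rewrite !mxE (bigD1 (lift ord0 i)) //= big1 ?addr0.
  by rewrite !mxE eqxx /= mulrN1 mulNr mulrC.
by move=> j ji; rewrite !mxE (negbTE ji) mulr0.
Qed.

Definition qf z : R := cabs (z 0 0) ^+ 2 - \sum_(i < n) cabs (z (lift ord0 i) 0) ^+ 2.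

Lemma herm_qf z : herm z z = (qf z)%:C%C.
Proof.
rewrite hermE /qf rmorphB /= rmorph_sum /= mul_conj; congr (_ - _).
by apply: eq_bigr => i _; rewrite mul_conj.
Qed.

Lemma qfU A z : inU A -> qf (A *m z) = qf z.
Proof. by move=> h; apply: complexI; rewrite -!herm_qf hermU. Qed.

Lemma qfZ a z : qf (a *: z) = cabs a ^+ 2 * qf z.
Proof.
by apply: complexI; rewrite -herm_qf hermZl hermZr mulrA mul_conj herm_qf -rmorphM.
Qed.

Lemma qf0 : qf 0 = 0.
Proof. by apply: complexI; rewrite -herm_qf herm0l. Qed.

Lemma qf_neq0 z : qf z != 0 -> z != 0.
Proof. by apply: contraNneq => ->; rewrite qf0. Qed.

Lemma qfD_orth z w : herm z w = 0 -> qf (z + w) = qf z + qf w.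
Proof.
move=> h; apply: complexI; rewrite -herm_qf !hermDl !hermDr h (herm_eq0C h).
by rewrite addr0 add0r !herm_qf -rmorphD.
Qed.

Lemma herm_cabs z w :
  cabs (\sum_(i < n) z (lift ord0 i) 0 * Num.conj (w (lift ord0 i) 0)) ^+ 2 <=
  (\sum_(i < n) cabs (z (lift ord0 i) 0) ^+ 2) * (\sum_(i < n) cabs (w (lift ord0 i) 0) ^+ 2).
Proof.
apply: le_trans (sum_sqr_CS _ _); rewrite lerXn2r ?nnegrE ?cabs_ge0 //.
  by apply: sumr_ge0 => i _; rewrite mulr_ge0 ?cabs_ge0.
by apply: le_trans (cabs_sum _ _ _) _; apply: ler_sum => i _; rewrite cabsM cabsJ.
Qed.

(* Quantitative form of the fact that the orthogonal complement of a positive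
   vector is negative definite. *)
Lemma orth_pos_bound u v i : 0 < qf v -> herm u v = 0 ->
  cabs (u i 0) ^+ 2 * qf v <= cabs (v 0 0) ^+ 2 * - qf u.
Proof.
rewrite /qf hermE => vpos /eqP; rewrite subr_eq0 => /eqP h.
have := herm_cabs u v; rewrite -h cabsM cabsJ => cs.
set s := \sum_(i < n) cabs (u _ _) ^+ 2 in cs *.
set t := \sum_(i < n) cabs (v _ _) ^+ 2 in cs vpos *.
have s0 : 0 <= s by apply: sumr_ge0 => j _; apply: sqr_ge0.
have t0 : 0 <= t by apply: sumr_ge0 => j _; apply: sqr_ge0.
set a := cabs (u 0 0) in cs *; set b := cabs (v 0 0) in cs vpos *.
rewrite exprMn in cs; have bpos : 0 < b ^+ 2 by lra.
have as_ : a ^+ 2 <= s.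
  by rewrite -(ler_pM2r bpos); apply: le_trans cs _; rewrite ler_wpM2l //; lra.
have us : cabs (u i 0) ^+ 2 <= s.
  case: (unliftP ord0 i) => [j ->|->//]; rewrite /s (bigD1 j) //= lerDl.
  by apply: sumr_ge0 => k _; apply: sqr_ge0.
(* After cancelling [s * b ^+ 2] this is [cs]. *)
have : s * (b ^+ 2 - t) <= b ^+ 2 * - (a ^+ 2 - s) by nra.
by apply: le_trans; rewrite ler_wpM2r // ltW.
Qed.

Lemma orth_pos_le0 u v : 0 < qf v -> herm u v = 0 -> qf u <= 0.
Proof.
move=> vpos h; rewrite leNgt; apply/negP => up.
have a0 : 0 < cabs (u 0 0) ^+ 2.
  apply: lt_le_trans up _; rewrite /qf lerBlDr lerDl.
  by apply: sumr_ge0 => j _; apply: sqr_ge0.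
have := orth_pos_bound 0 vpos h; apply/negP; rewrite -ltNge.
apply: le_lt_trans (_ : 0 < _); last exact: mulr_gt0.
by rewrite mulrN oppr_le0 mulr_ge0 ?sqr_ge0 ?ltW.
Qed.

Lemma orth_pos_eq0 u v : 0 < qf v -> herm u v = 0 -> 0 <= qf u -> u = 0.
Proof.
move=> vpos h up; apply/colP => i; rewrite mxE; apply/eqP; rewrite -cabs_eq0.
have := orth_pos_bound i vpos h; have := sqr_ge0 (cabs (v 0 0)) => b0 H.
rewrite -sqrf_eq0 eq_le sqr_ge0 andbT -(ler_pM2r vpos) mul0r.
by apply: le_trans H _; rewrite mulrN oppr_le0 mulr_ge0.
Qed.

Lemma pos_vecP v : pos_vec v <-> 0 < qf v.
Proof. by rewrite /pos_vec herm_qf ltcR. Qed.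

Lemma null_vecP v : null_vec v <-> v != 0 /\ qf v = 0.
Proof. by rewrite /null_vec herm_qf; split=> -[? h]; split=> //; [exact: complexI|rewrite h]. Qed.

Lemma closure_vecP v : closure_vec v <-> v != 0 /\ 0 <= qf v.
Proof. by rewrite /closure_vec herm_qf lecR. Qed.

Lemma null_closure v : null_vec v -> closure_vec v.
Proof. by move=> /null_vecP[? h]; apply/closure_vecP; rewrite h. Qed.

Lemma pos_closure v : pos_vec v -> closure_vec v.
Proof. by move=> /pos_vecP h; apply/closure_vecP; rewrite qf_neq0 ?lt0r_neq0 // ltW. Qed.

Lemma prop_sym v w : w != 0 -> proportional v w -> proportional w v.
Proof.
move=> w0 [a e]; exists a^-1; rewrite e scalerA mulVf ?scale1r //.
by apply: contraNneq w0 => a0; rewrite e a0 scale0r.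
Qed.

Lemma prop_trans v w z : proportional v w -> proportional w z -> proportional v z.
Proof. by move=> [a ->] [b ->]; exists (b * a); rewrite scalerA. Qed.

(** A positive vector has a negative definite orthogonal complement, so both vectors are null.
    Subtracting the multiple of [u] that cancels the 0-th coordinate of [w] leaves a null vector
    with 0-th coordinate 0, which must vanish. *)
Lemma closure_orth_prop u w : closure_vec u -> closure_vec w -> herm u w = 0 ->
  proportional u w.
Proof.
move=> /closure_vecP[u0 uq] /closure_vecP[w0 wq] h.
have [up|un] := ltP 0 (qf u).
  by move/eqP: w0 => []; apply: (orth_pos_eq0 up (herm_eq0C h) wq).
have [wp|wn] := ltP 0 (qf w).
  by move/eqP: u0 => []; apply: (orth_pos_eq0 wp h uq).
have qu : qf u = 0 by apply/eqP; rewrite eq_le un uq.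
have qw : qf w = 0 by apply/eqP; rewrite eq_le wn wq.
have nz z : z != 0 -> qf z = 0 -> z 0 0 != 0.
  move=> z0 /eqP; apply: contraTneq => e; rewrite /qf e cabs0 expr0n sub0r oppr_eq0.
  rewrite psumr_eq0; last by move=> *; apply: sqr_ge0.
  apply/allP => /= H; case/negP: z0; apply/eqP/colP => i; rewrite mxE.
  case: (unliftP ord0 i) => [j ->|->//]; apply/eqP; have := H j.
  by rewrite mem_index_enum sqrf_eq0 cabs_eq0 => /(_ isT).
have u00 := nz u u0 qu; set a := w 0 0 / u 0 0; exists a.
set d := w - a *: u; have d0 : d 0 0 = 0 by rewrite !mxE mulfVK // subrr.
have dq : qf d = 0.
  apply: complexI; rewrite -herm_qf hermDl !hermDr !hermNl !hermNr !hermZl !hermZr.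
  by rewrite h (herm_eq0C h) !herm_qf qu qw !mulr0 !(oppr0, addr0, subr0).
apply/eqP; rewrite -subr_eq0 -/d; apply/negPn/negP => dn0.
by move/eqP: (nz d dn0 dq).
Qed.

End Herm.

(** * Unitary matrices and their fixed points *)

Section Unitary.
Variable n : nat.
Local Notation mat := 'M[C]_(n.+1).
Local Notation vec := 'cV[C]_(n.+1).
Implicit Types (A B g h k : mat) (u v w x y z : vec) (a b l m : C).

Lemma inU_adjK A : inU A -> Jmx n *m adjm A *m Jmx n *m A = 1%:M.
Proof. by move=> h; rewrite -!mulmxA [adjm A *m _]mulmxA h JmxJ. Qed.

Lemma inU_unit A : inU A -> A \in unitmx.
Proof. by move=> /inU_adjK /mulmx1_unit[]. Qed.

Lemma inU_invmx A : inU A -> invmx A = Jmx n *m adjm A *m Jmx n.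
Proof.
move=> h; have /(congr1 (mulmx^~ (invmx A))) := inU_adjK h.
by rewrite mul1mx -(mulmxA _ A) mulmxV ?inU_unit // mulmx1.
Qed.

Lemma inU1 : inU (1%:M : mat).
Proof. by rewrite /inU /adjm map_mx1 trmx1 mul1mx mulmx1. Qed.

Lemma inUM A B : inU A -> inU B -> inU (A *m B).
Proof.
rewrite /inU adjmM => hA hB.
by rewrite -{}[RHS]hB -[in RHS]hA !mulmxA.
Qed.

Lemma inUV A : inU A -> inU (invmx A).
Proof.
move=> h; rewrite /inU {2}(inU_invmx h) !mulmxA.
rewrite (inU_invmx h) !adjmM adjm_Jmx adjmK.
have e : A *m (Jmx n *m adjm A *m Jmx n) = 1%:M.
  by rewrite -inU_invmx // mulmxV ?inU_unit.
have -> : Jmx n *m (A *m Jmx n) *m Jmx n *m Jmx n *m adjm A *m Jmx n =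
  Jmx n *m A *m (Jmx n *m Jmx n) *m (Jmx n *m adjm A *m Jmx n) by rewrite !mulmxA.
by rewrite JmxJ mulmx1 -mulmxA e mulmx1.
Qed.

Lemma inUX A i : inU A -> inU (A ^+ i).
Proof.
move=> h; elim: i => [|i IH]; first by rewrite expr0; apply: inU1.
by rewrite exprS; apply: inUM.
Qed.

Lemma nrm_Jl p (X : 'M[C]_(n.+1, p)) : nrm (Jmx n *m X) = nrm X.
Proof.
apply: eq_bigr => i _; apply: eq_bigr => j _.
rewrite mxE (bigD1 i) //= big1 ?addr0.
  by rewrite mxE eqxx cabsM; case: ifP; rewrite ?cabsN cabs1 mul1r.
by move=> t ti; rewrite mxE eq_sym (negbTE ti) mul0r.
Qed.

Lemma nrm_invmx A : inU A -> nrm (invmx A) = nrm A.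
Proof.
move=> h; rewrite inU_invmx // -mulmxA nrm_Jl -nrm_adjm adjmM adjmK adjm_Jmx.
by rewrite nrm_Jl.
Qed.

Lemma nrm_inU_ge1 A : inU A -> 1 <= nrm A.
Proof.
move=> h; have := nrmM (invmx A) A; rewrite mulVmx ?inU_unit // nrm1 nrm_invmx //.
have := nrm_ge0 A; have : 1 <= n.+1%:R :> R by rewrite ler1n.
by move: (n.+1%:R) => N *; nra.
Qed.

Lemma inU_id lam : inU (lam%:M : mat) -> `|lam| = 1.
Proof.
move=> /matrixP/(_ 0 0); rewrite /adjm map_scalar_mx tr_scalar_mx mul_scalar_mx.
rewrite mul_mx_scalar !mxE /= mulr1 mul_conj => h; apply/norm1_cabs.
have {h} : cabs lam ^+ 2 == 1 by apply/eqP/complexI.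
by rewrite sqrp_eq1 ?cabs_ge0 // => /eqP.
Qed.

Lemma is_idP A : is_id A <-> exists2 lam, `|lam| = 1 & A = lam%:M.
Proof.
by split=> [[l [h ->]]|[l h ->]]; exists l => //; rewrite ?[l *: 1%:M]scalemx1.
Qed.

Lemma inU_scalar_id lam A : inU A -> A = lam%:M -> is_id A.
Proof. by move=> h e; apply/is_idP; exists lam => //; apply: inU_id; rewrite -e. Qed.

Lemma fixesM A B u : fixes A u -> fixes B u -> fixes (A *m B) u.
Proof.
by move=> [a ha] [b hb]; exists (b * a); rewrite -mulmxA hb -scalemxAr ha scalerA.
Qed.

Lemma fixes_prop A u w : fixes A u -> proportional u w -> fixes A w.
Proof.
by move=> [a e] [b ->]; exists a; rewrite -scalemxAr e !scalerA mulrC.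
Qed.

Lemma fixes_conj g A u : inU g -> fixes A u -> fixes (g *m A *m invmx g) (g *m u).
Proof.
move=> gU [a e]; exists a; rewrite -!mulmxA [invmx g *m _]mulmxA mulVmx ?inU_unit //.
by rewrite mul1mx e -scalemxAr.
Qed.

Lemma fixes_id A u : is_id A -> fixes A u.
Proof. by case/is_idP => l _ ->; exists l; rewrite mul_scalar_mx. Qed.

Lemma eigen_inv A u a : inU A -> u != 0 -> A *m u = a *: u ->
  a != 0 /\ invmx A *m u = a^-1 *: u.
Proof.
move=> AU u0 e.
have e' : u = a *: (invmx A *m u).
  by rewrite scalemxAr -e mulmxA mulVmx ?inU_unit // mul1mx.
have a0 : a != 0 by apply: contraNneq u0 => a0; rewrite e' a0 scale0r.
by split=> //; rewrite [in RHS]e' scalerA mulVf // scale1r.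
Qed.

Lemma fixesV A u : inU A -> u != 0 -> fixes A u -> fixes (invmx A) u.
Proof. by move=> AU u0 [a] /(eigen_inv AU u0)[_ e]; exists a^-1. Qed.

Lemma eigenX A u a i : A *m u = a *: u -> A ^+ i *m u = a ^+ i *: u.
Proof.
move=> e; elim: i => [|i IH]; first by rewrite !expr0 mul1mx scale1r.
by rewrite exprS -mulmxA IH -scalemxAr e scalerA exprSr.
Qed.

(** Two eigenvectors that are both non-orthogonal to a third one therefore have the same eigenvalue;
    this is how eigenvalues are compared below. *)
Lemma eigen_herm A u w a b : inU A -> A *m u = a *: u -> A *m w = b *: w ->
  herm u w != 0 -> a * Num.conj b = 1.
Proof.
move=> AU eu ew h; apply: (mulIf h); rewrite mul1r -[RHS](hermU _ _ AU) eu ew.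
by rewrite hermZl hermZr mulrA.
Qed.

Lemma unitary_neq0 A u : inU A -> u != 0 -> A *m u != 0.
Proof.
move=> AU; apply: contraNneq => e; rewrite -[u]mul1mx -(mulVmx (inU_unit AU)).
by rewrite -mulmxA e mulmx0.
Qed.

Lemma nullU A u : inU A -> null_vec u -> null_vec (A *m u).
Proof.
by move=> AU /null_vecP[u0 q]; apply/null_vecP; rewrite unitary_neq0 ?qfU.
Qed.

Lemma closureU A u : inU A -> closure_vec u -> closure_vec (A *m u).
Proof.
by move=> AU /closure_vecP[u0 q]; apply/closure_vecP; rewrite unitary_neq0 ?qfU.
Qed.

Lemma propU A u w : inU A -> proportional (A *m u) (A *m w) -> proportional u w.
Proof.
move=> AU [a e]; exists a; rewrite -[w]mul1mx -(mulVmx (inU_unit AU)) -mulmxA e.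
by rewrite -scalemxAr mulmxA mulVmx ?inU_unit // mul1mx.
Qed.

Lemma closure_herm_neq0 u w : closure_vec u -> closure_vec w ->
  ~ proportional u w -> herm u w != 0.
Proof. by move=> cu cw np; apply/eqP=> /(closure_orth_prop cu cw). Qed.

(** [loxodromic] describes only the set of fixed points. The dynamics come from the eigenvalues at
    the two null eigenvectors, whose moduli differ from 1 and are inverse to each other
    ([axial_lm]). *)
Record axial h x y l m : Prop := Axial {
  ax_U : inU h;
  ax_x : null_vec x;
  ax_y : null_vec y;
  ax_xy : ~ proportional x y;
  ax_hx : h *m x = l *: x;
  ax_hy : h *m y = m *: y;
  ax_l : cabs l != 1 }.

Lemma nprop_sym x y : null_vec x -> ~ proportional x y -> ~ proportional y x.
Proof. by move=> [x0 _] np /(prop_sym x0). Qed.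

Lemma axial_herm h x y l m : axial h x y l m -> herm x y != 0.
Proof. by case=> *; apply: closure_herm_neq0 => //; apply: null_closure. Qed.

Lemma axial_lm h x y l m : axial h x y l m -> cabs l * cabs m = 1.
Proof.
move=> ax; have [hU _ _ _ hx hy _] := ax.
have := eigen_herm hU hx hy (axial_herm ax) => /(congr1 cabs).
by rewrite cabsM cabsJ cabs1.
Qed.

Lemma axial_sym h x y l m : axial h x y l m -> axial h y x m l.
Proof.
move=> ax; have lm := axial_lm ax; case: ax => hU nx ny xy hx hy hl; split=> //.
  exact: nprop_sym.
by apply: contraNneq hl => m1; rewrite -lm m1 mulr1.
Qed.

Lemma axialX h x y l m d : axial h x y l m -> (0 < d)%N ->
  axial (h ^+ d) x y (l ^+ d) (m ^+ d).
Proof.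
case=> hU nx ny xy hx hy hl d0; split=> //; try exact: eigenX; first exact: inUX.
by rewrite cabsX -(prednK d0) pexpr_eq1 ?cabs_ge0.
Qed.

Lemma axialV h x y l m : axial h x y l m -> axial (invmx h) x y l^-1 m^-1.
Proof.
case=> hU nx ny xy hx hy hl.
have [x0 _] := nx; have [y0 _] := ny.
have [_ ex] := eigen_inv hU x0 hx; have [_ ey] := eigen_inv hU y0 hy.
by split=> //; [exact: inUV | rewrite cabsV invr_eq1].
Qed.

Lemma axial_conj g h x y l m : inU g -> axial h x y l m ->
  axial (g *m h *m invmx g) (g *m x) (g *m y) l m.
Proof.
move=> gU [hU nx ny xy hx hy hl].
have e u a : h *m u = a *: u -> g *m h *m invmx g *m (g *m u) = a *: (g *m u).
  move=> eu; rewrite -!mulmxA [invmx g *m _]mulmxA mulVmx ?inU_unit //.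
  by rewrite mul1mx eu -scalemxAr.
split=> //; try exact: nullU; try exact: e.
  by apply: inUM; [apply: inUM|apply: inUV].
by move=> /(propU gU).
Qed.

(** * The plane spanned by two boundary points and its orthogonal complement *)

Section Plane.
Variables x y : vec.
Hypotheses (nx : null_vec x) (ny : null_vec y) (xy : ~ proportional x y).

Let c0 : herm x y != 0.
Proof. by apply: closure_herm_neq0 => //; apply: null_closure. Qed.

Lemma plane_decomp u : exists a b z,
  [/\ u = a *: x + b *: y + z, herm z x = 0 & herm z y = 0].
Proof.
have [_ qx] := nx; have [_ qy] := ny.
have c0' : herm y x != 0.
  by apply: contraNneq c0 => e; rewrite hermC e rmorph0.
pose a := herm u y / herm x y; pose b := herm u x / herm y x.
exists a, b, (u - (a *: x + b *: y)); split.
- by rewrite addrC subrK.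
- by rewrite hermDl hermNl hermDl !hermZl qx mulr0 add0r mulfVK // subrr.
- by rewrite hermDl hermNl hermDl !hermZl qy mulr0 addr0 mulfVK // subrr.
Qed.

Lemma plane_pos : exists s, 0 < qf (x + s *: y) /\ s != 0.
Proof.
have [_ qx] := nx; have [_ qy] := ny.
(* This scalar [s] makes [herm x (s *: y)] equal to 1, so the form takes the value 2. *)
exists (Num.conj (herm x y)^-1); split; last by rewrite conjC_eq0 invr_eq0.
suff -> : qf (x + Num.conj (herm x y)^-1 *: y) = 2%:R by [].
apply: complexI; rewrite -herm_qf hermDl !hermDr !hermZl !hermZr qx qy (hermC x y) conjCK.
by rewrite mulVf // -rmorphM mulVf // rmorph1 !mulr0 addr0 add0r rmorph_nat.
Qed.

Lemma plane_orth z : herm z x = 0 -> herm z y = 0 -> qf z <= 0.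
Proof.
move=> zx zy; have [s [vpos _]] := plane_pos; apply: (orth_pos_le0 vpos).
by rewrite hermDr hermZr zx zy mulr0 addr0.
Qed.

Lemma plane_orth0 z : herm z x = 0 -> herm z y = 0 -> 0 <= qf z -> z = 0.
Proof.
move=> zx zy; have [s [vpos _]] := plane_pos; apply: (orth_pos_eq0 vpos).
by rewrite hermDr hermZr zx zy mulr0 addr0.
Qed.

(** [y] is null and orthogonal to [z], so [qf z] equals [qf (b *: y + z)] and is nonnegative,
    whereas the complement of the plane is negative definite. *)
Lemma plane_half b z : herm z x = 0 -> herm z y = 0 -> closure_vec (b *: y + z) -> z = 0.
Proof.
have [_ qy] := ny => zx zy /closure_vecP[_ q]; apply: plane_orth0 => //.
move: q; rewrite qfD_orth ?qfZ; last by rewrite hermZl (herm_eq0C zy) mulr0.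
have -> : qf y = 0 by apply: complexI; rewrite -herm_qf.
by rewrite mulr0 add0r.
Qed.

End Plane.

Lemma axial_orth h x y l m z : axial h x y l m -> herm z x = 0 -> herm (h *m z) x = 0.
Proof.
move=> ax zx; have [hU nx _ _ hx _ _] := ax; have [x0 _] := nx.
have [l0 _] := eigen_inv hU x0 hx.
have := hermU z x hU; rewrite hx hermZr zx => /eqP.
by rewrite mulf_eq0 conjC_eq0 (negbTE l0) => /eqP.
Qed.

Lemma plane_coord x y a b z a' b' z' : null_vec x -> null_vec y -> ~ proportional x y ->
  herm z x = 0 -> herm z y = 0 -> herm z' x = 0 -> herm z' y = 0 ->
  a *: x + b *: y + z = a' *: x + b' *: y + z' -> a = a' /\ b = b'.
Proof.
move=> nx ny xy zx zy zx' zy' e.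
have c0 : herm x y != 0 by apply: closure_herm_neq0 => //; apply: null_closure.
have c1 : herm y x != 0 by apply: contraNneq c0 => h; rewrite hermC h rmorph0.
have [_ qx] := nx; have [_ qy] := ny.
split.
  apply: (mulIf c0); have := congr1 (fun t => herm t y) e.
  by rewrite /= !hermDl !hermZl qy zy zy' !mulr0 !addr0.
apply: (mulIf c1); have := congr1 (fun t => herm t x) e.
by rewrite /= !hermDl !hermZl qx zx zx' !mulr0 !addr0 !add0r.
Qed.

(** Compare coordinates along [x] and [y]: if both are nonzero then [l = m], against
    [cabs l * cabs m = 1] and [cabs l != 1]. If one is zero, [plane_half] kills the transverse
    component. *)
Lemma axial_fix h x y l m u : axial h x y l m -> closure_vec u -> fixes h u ->
  proportional x u \/ proportional y u.
Proof.
move=> ax cu [nu e]; have [hU nx ny xy hx hy hl] := ax.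
have ax' := axial_sym ax.
have [a [b [z [ue zx zy]]]] := plane_decomp nx ny xy u.
have e2 : (a * l) *: x + (b * m) *: y + h *m z = (nu * a) *: x + (nu * b) *: y + nu *: z.
  by rewrite -!scalerA -hx -hy !scalemxAr -!mulmxDr -ue e ue !scalerDr.
have [e3 e4] : a * l = nu * a /\ b * m = nu * b.
  apply: (plane_coord nx ny xy (axial_orth ax zx) (axial_orth ax' zy) _ _ e2).
    by rewrite hermZl zx mulr0.
  by rewrite hermZl zy mulr0.
have [a0|a0] := eqVneq a 0.
  right; exists b; have z0 : z = 0.
    by apply: (@plane_half x y nx ny xy b) => //; rewrite ue a0 scale0r add0r in cu.
  by rewrite ue a0 z0 scale0r add0r addr0.
have [b0|b0] := eqVneq b 0.
  left; exists a; have z0 : z = 0.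
    apply: (@plane_half y x ny nx (nprop_sym nx xy) a) => //.
    by rewrite ue b0 scale0r addr0 in cu.
  by rewrite ue b0 z0 scale0r !addr0.
case/negP: hl; have lm : l = m.
  transitivity nu; first by apply: (mulfI a0); rewrite e3 mulrC.
  by apply: (mulfI b0); rewrite e4 mulrC.
by have := axial_lm ax; rewrite -lm -expr2 => /eqP; rewrite sqrp_eq1 ?cabs_ge0.
Qed.

(** If [l] had modulus 1, [eigen_herm] would give [l = m]; then [h] would be scalar on the span of
    [x] and [y] and fix a positive vector there, which is one fixed point too many. *)
Lemma loxodromic_axial h x y : inU h -> loxodromic h -> null_vec x -> null_vec y ->
  fixes h x -> fixes h y -> ~ proportional x y -> exists l m, axial h x y l m.
Proof.
move=> hU [_ [v [w [nv [nw [fv [fw [vw H]]]]]]]] nx ny [l hx] [m hy] xy.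
exists l, m; split=> //; apply/eqP => l1.
have c0 : herm x y != 0 by apply: closure_herm_neq0 => //; apply: null_closure.
have lm := eigen_herm hU hx hy c0.
have e : l = m.
  have ll : l * Num.conj l = 1 by rewrite mul_conj l1 expr1n.
  have cl : Num.conj m = Num.conj l.
    have l0 : l != 0 by apply: contra_eq_neq ll => ->; rewrite mul0r eq_sym oner_neq0.
    by apply: (mulfI l0); rewrite ll lm.
  by rewrite -[l]conjCK -cl conjCK.
have [s [spos s0]] := plane_pos nx ny xy.
have fu : fixes h (x + s *: y).
  by exists l; rewrite mulmxDr -scalemxAr hx hy e scalerDr !scalerA mulrC.
have cu : closure_vec (x + s *: y) by apply: pos_closure; apply/pos_vecP.
have np p : null_vec p -> ~ proportional p (x + s *: y).
  move=> /null_vecP[_ qp] [a e1]; move: spos; rewrite e1 qfZ qp mulr0.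
  by rewrite ltxx.
by case: (H _ cu fu) => /np.
Qed.

Lemma axial_loxodromic h x y l m : axial h x y l m -> loxodromic h.
Proof.
move=> ax; have [hU nx ny xy hx hy hl] := ax; split.
  move=> /is_idP[c /norm1_cabs c1 e]; case/negP: hl; have [x0 _] := nx.
  have : (c - l) *: x = 0 by rewrite scalerBl -hx e mul_scalar_mx subrr.
  by move/eqP; rewrite scaler_eq0 (negbTE x0) orbF subr_eq0 => /eqP <-; apply/eqP.
exists x, y; split; first exact: nx.
split; first exact: ny.
split; first by exists l.
split; first by exists m.
by split=> // u; apply: axial_fix ax.
Qed.

End Unitary.

(** * Pigeonhole arguments in discrete subgroups *)

Lemma cabs_sqr (z : C) : cabs z ^+ 2 = complex.Re z ^+ 2 + complex.Im z ^+ 2.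
Proof. by apply: complexI; rewrite add_Re2_Im2 cabsE -rmorphXn. Qed.

Lemma cabs_le_ReIm (z : C) : cabs z <= `|complex.Re z| + `|complex.Im z|.
Proof.
rewrite -(@ler_pXn2r _ 2) ?nnegrE ?addr_ge0 ?cabs_ge0 // cabs_sqr.
rewrite -(real_normK (num_real (complex.Re z))) -(real_normK (num_real (complex.Im z))).
move: (normr_ge0 (complex.Re z)) (normr_ge0 (complex.Im z)).
by move: (`|complex.Re z|) (`|complex.Im z|) => a b; nra.
Qed.

Lemma Re_le_cabs (z : C) : `|complex.Re z| <= cabs z.
Proof.
rewrite -(@ler_pXn2r _ 2) ?nnegrE ?cabs_ge0 // cabs_sqr real_normK ?num_real //.
by rewrite lerDl sqr_ge0.
Qed.

Lemma Im_le_cabs (z : C) : `|complex.Im z| <= cabs z.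
Proof.
rewrite -(@ler_pXn2r _ 2) ?nnegrE ?cabs_ge0 // cabs_sqr real_normK ?num_real //.
by rewrite lerDr sqr_ge0.
Qed.

(** Pigeonhole: the range of every real and imaginary part is cut into finitely many cells of side
    [e], and two terms of the sequence share all their cells. *)
Lemma bounded_close p r (D d : R) (q : nat -> 'M[C]_(p, r)) : 0 < d ->
  (forall i, nrm (q i) <= D) -> exists i j, (i < j)%N /\ nrm (q j - q i) < d.
Proof.
move=> d0 bq; have D0 : 0 <= D by apply: le_trans (nrm_ge0 _) (bq 0%N).
set N := (p * r)%:R : R; have N0 : 0 <= N by rewrite ler0n.
(* Terms in the same cells differ by at most [2 * e] in each entry, hence by at most [2 * N * e < d]
   in norm. *)
pose e := d / (2 * N + 1).
have e0 : 0 < e by rewrite divr_gt0 //; lra.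
pose K := Num.truncn ((2 * D) / e).
pose part (b : bool) (z : C) := if b then complex.Re z else complex.Im z.
pose cell i : {ffun 'I_p * 'I_r * bool -> 'I_K.+1} :=
  [ffun t => inord (Num.truncn ((part t.2 (q i t.1.1 t.1.2) + D) / e))].
have partB b (z : C) : cabs z <= D -> 0 <= part b z + D <= 2 * D.
  move=> zD; have : `|part b z| <= D.
    by apply: le_trans zD; case: b; [apply: Re_le_cabs|apply: Im_le_cabs].
  by rewrite ler_norml => /andP[]; lra.
have celle i (t : 'I_p * 'I_r * bool) : cell i t =
    Num.truncn ((part t.2 (q i t.1.1 t.1.2) + D) / e) :> nat.
  rewrite ffunE inordK // ltnS; apply: le_truncn.
  have /andP[_ h] := partB t.2 (q i t.1.1 t.1.2) (le_trans (nrm_entry _ _ _) (bq i)).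
  by rewrite ler_pM2r ?invr_gt0.
pose T := {ffun 'I_p * 'I_r * bool -> 'I_K.+1}.
have : ~ injective (fun i : 'I_(#|T|.+1) => cell i).
  by move=> /leq_card; rewrite card_ord ltnn.
have close i j : cell i = cell j -> nrm (q j - q i) < d.
  move=> ce; have pe b a c : `|part b (q j a c) - part b (q i a c)| <= e.
    have E0 : cell i (a, c, b) = cell j (a, c, b) :> nat by rewrite ce.
    have /andP[hi _] := partB b (q i a c) (le_trans (nrm_entry _ a c) (bq i)).
    have /andP[hj _] := partB b (q j a c) (le_trans (nrm_entry _ a c) (bq j)).
    move: E0; rewrite !celle /=; set X := part b _ + D; set Y := part b _ + D.
    have X0 : 0 <= X / e by apply: divr_ge0 => //; apply: ltW.
    have Y0 : 0 <= Y / e by apply: divr_ge0 => //; apply: ltW.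
    have /andP[h1 h2] := truncn_itv X0; have /andP[h3 h4] := truncn_itv Y0.
    move=> E; rewrite E in h1 h2.
    have hX : X = X / e * e by rewrite mulfVK // gt_eqF.
    have hY : Y = Y / e * e by rewrite mulfVK // gt_eqF.
    have -> : part b (q j a c) - part b (q i a c) = (Y / e - X / e) * e.
      by rewrite mulrBl -hX -hY /X /Y; ring.
    rewrite normrM (gtr0_norm e0); apply: ler_piMl; first exact: ltW.
    rewrite ler_norml.
    by move: h1 h2 h3 h4; rewrite -!natr1; lra.
  apply: le_lt_trans (nrm_le_entry (_ : forall a c, cabs ((q j - q i) a c) <= 2 * e)) _.
    move=> a c; apply: le_trans (cabs_le_ReIm _) _; rewrite !mxE.
    rewrite raddfB /= raddfB /=; have := pe true a c; have := pe false a c.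
    by rewrite /part; lra.
  rewrite -/N /e; have N1 : 0 < 2 * N + 1 by lra.
  by rewrite mulrA mulrA ltr_pdivrMr //; nra.
move=> ninj; have : ~~ injectiveb (fun i : 'I_(#|T|.+1) => cell i).
  by apply/injectiveP.
case/injectivePn => i [j ij ce].
have [lt|lt|eq] := ltngtP i j.
- by exists i, j; split=> //; apply: close.
- by exists j, i; split=> //; apply: close.
- by case/eqP: ij; apply: val_inj.
Qed.

Section Discrete.
Variable n : nat.
Local Notation mat := 'M[C]_(n.+1).
Local Notation vec := 'cV[C]_(n.+1).
Implicit Types (A B g h k : mat) (u v w x y z : vec) (a b l m : C) (S : mat -> Prop).

(** Properness of the action: each basis vector is a multiple of [v] plus some [u j] orthogonal to
    [v]. The image of the first part is controlled by [D]; the second goes to the complement of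
    [M *m v] with the same [qf], where [orth_pos_bound] applies. *)
Lemma nrm_le_of_image v (D : R) : 0 < qf v ->
  exists K : R, forall M : mat, inU M -> nrm (M *m v) <= D -> nrm M <= K.
Proof.
move=> vpos; pose e j : vec := delta_mx j 0.
pose t j := herm (e j) v / herm v v; pose u j := e j - t j *: v.
have hv0 : herm v v != 0.
  by rewrite herm_qf; apply/eqP => /complexI h; rewrite h ltxx in vpos.
have uo j : herm (u j) v = 0 by rewrite hermDl hermNl hermZl mulfVK // subrr.
(* The bound obtained is on a square [r ^+ 2]; [r <= 1 + r ^+ 2] avoids the square root. *)
pose c j := cabs (t j) * D + (1 + D ^+ 2 * - qf (u j) / qf v).
exists ((n.+1 * n.+1)%:R * \sum_j `|c j|) => M MU MD.
apply: nrm_le_entry => i j.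
apply: le_trans (_ : `|c j| <= _); last first.
  by rewrite (bigD1 j) //= lerDl; apply: sumr_ge0.
apply: le_trans (ler_norm _).
have -> : M i j = (t j *: (M *m v) + M *m u j) i 0.
  rewrite scalemxAr -mulmxDr /u addrC subrK.
  by rewrite -colE mxE.
rewrite mxE; apply: le_trans (cabsD _ _) _; apply: lerD.
  rewrite mxE cabsM ler_wpM2l ?cabs_ge0 //.
  by apply: le_trans MD; apply: nrm_entry.
have D0 : 0 <= D by apply: le_trans (nrm_ge0 _) MD.
have vM : 0 < qf (M *m v) by rewrite qfU.
have := orth_pos_bound i vM (_ : herm (M *m u j) (M *m v) = 0).
rewrite hermU // => /(_ (uo j)); rewrite !qfU //.
have uq : 0 <= - qf (u j) by rewrite oppr_ge0 (orth_pos_le0 vpos).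
have bD : cabs ((M *m v) 0 0) ^+ 2 <= D ^+ 2.
  by rewrite lerXn2r ?nnegrE ?cabs_ge0 //; apply: le_trans MD; apply: nrm_entry.
move=> H; have {}H : cabs ((M *m u j) i 0) ^+ 2 <= D ^+ 2 * - qf (u j) / qf v.
  by rewrite ler_pdivlMr //; apply: le_trans H _; rewrite ler_wpM2r.
apply: le_trans (_ : 1 + cabs ((M *m u j) i 0) ^+ 2 <= _); last by rewrite lerD2l.
by move: (cabs _) => r; nra.
Qed.

Lemma mulmx_invX A i : A \in unitmx -> A ^+ i *m invmx A ^+ i = 1%:M.
Proof.
move=> AU; elim: i => [|i IH]; first by rewrite !expr0 mul1mx.
rewrite exprS exprSr !mulmxE -mulrA [A ^+ i * _]mulrA -mulmxE IH mul1mx.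
by rewrite mulmxV.
Qed.

Lemma mulmx_invX' A i : A \in unitmx -> invmx A ^+ i *m A ^+ i = 1%:M.
Proof. by move=> AU; rewrite -{2}[A]invmxK mulmx_invX ?unitmx_inv. Qed.

Lemma subgroupX S k i : PUsubgroup S -> S k -> S (k ^+ i).
Proof.
case=> S1 _ SM _ Sk; elim: i => [|i IH]; first by rewrite expr0.
by rewrite exprS; apply: SM.
Qed.

Lemma discrete_id S : PUsubgroup S -> pu_discrete S ->
  exists2 d : R, 0 < d & forall B, S B -> nrm (B - 1%:M) < d -> is_id B.
Proof.
move=> [S1 _ _ _] /(_ _ S1)[d d0 H]; exists d => // B SB near.
apply: H => //; exists 1; split=> [|i j]; first by rewrite normr1.
rewrite mul1r cabsE ltcR; apply: le_lt_trans near; rewrite cabsB.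
by have := nrm_entry (B - 1%:M) i j; rewrite 3!mxE.
Qed.

Lemma discrete_pigeonhole S (q : nat -> mat) (D : R) : PUsubgroup S -> pu_discrete S ->
  (forall i, S (q i)) -> (forall i, nrm (q i) <= D) ->
  exists i j nu, (i < j)%N /\ q j = nu *: q i.
Proof.
move=> Sg Sd Sq bq; have [d d0 H] := discrete_id Sg Sd.
have [S1 SU SM SV] := Sg.
have D0 : 0 <= D by apply: le_trans (nrm_ge0 _) (bq 0%N).
have D1 : 0 < D + 1 by lra.
(* The tolerance is divided by [D + 1] because multiplying by [invmx (q i)] costs a factor at most
   [D]. *)
have [i [j [ij cl]]] := bounded_close (divr_gt0 d0 D1) bq.
have /is_idP[nu _ e] : is_id (invmx (q i) *m q j).
  apply: H; first by apply: SM => //; apply: SV.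
  have -> : invmx (q i) *m q j - 1%:M = invmx (q i) *m (q j - q i).
    by rewrite mulmxBr mulVmx // inU_unit //; apply: SU.
  apply: le_lt_trans (nrmM _ _) _; rewrite nrm_invmx; last exact: SU.
  apply: le_lt_trans (_ : (D + 1) * nrm (q j - q i) < _).
    by rewrite ler_wpM2r ?nrm_ge0 //; have := bq i; lra.
  by move: cl; rewrite ltr_pdivlMr // mulrC.
exists i, j, nu; split=> //.
rewrite -[LHS]mul1mx -(mulmxV (inU_unit (SU _ (Sq i)))) -mulmxA e.
by rewrite mul_mx_scalar.
Qed.

(** The eigenvalue of [k] at [v] has modulus 1, so the images of [v] under powers of [k] are
    bounded, hence so are the powers; two of them agree up to a scalar. *)
Lemma elliptic_finite_order S k v : PUsubgroup S -> pu_discrete S -> S k ->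
  0 < qf v -> fixes k v -> finite_order k.
Proof.
move=> Sg Sd Sk vpos [a e]; have [S1 SU SM SV] := Sg; have kU := SU _ Sk.
have a1 : cabs a = 1.
  have := qfU v kU; rewrite e qfZ => /(congr1 (fun t => t / qf v)).
  rewrite mulfK ?divff ?gt_eqF // => /eqP; rewrite sqrp_eq1 ?cabs_ge0 //.
  by move/eqP.
have [K HK] := nrm_le_of_image (nrm v) vpos.
have bK i : nrm (k ^+ i) <= K.
  apply: HK; first exact: inUX.
  by rewrite (eigenX _ e) nrmZ cabsX a1 expr1n mul1r.
have [i [j [nu [ij E]]]] := discrete_pigeonhole Sg Sd (fun i => subgroupX i Sg Sk) bK.
exists (j - i)%N; split; first by rewrite subn_gt0.
apply: (@inU_scalar_id _ nu); first exact: inUX.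
have := E; rewrite -{1}(subnK (ltnW ij)) exprD => /(congr1 (mulmx^~ (invmx k ^+ i))).
rewrite -scalemxAl mulmx_invX ?inU_unit // -mulmxE -mulmxA mulmx_invX ?inU_unit //.
by rewrite mulmx1 scalemx1.
Qed.

Lemma axial_orthX h x y l m z i : axial h x y l m -> herm z x = 0 ->
  herm (h ^+ i *m z) x = 0.
Proof.
move=> ax zx; elim: i => [|i IH]; first by rewrite expr0 mul1mx.
by rewrite exprS -mulmxA; apply: (axial_orth ax).
Qed.

(** The vectors [h ^+ i *m z] keep their value of [qf] and stay orthogonal to a positive vector of
    the plane, where the form is definite. *)
Lemma axial_orth_bounded h x y l m z : axial h x y l m ->
  herm z x = 0 -> herm z y = 0 ->
  exists2 Z : R, 0 <= Z & forall i, nrm (h ^+ i *m z) <= Z.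
Proof.
move=> ax zx zy; have [hU nx ny xy _ _ _] := ax.
have [s [vpos _]] := plane_pos nx ny xy; set v := x + s *: y in vpos.
pose B := 1 + cabs (v 0 0) ^+ 2 * - qf z / qf v.
have q0 : 0 <= - qf z by rewrite oppr_ge0 (plane_orth nx ny xy).
have B0 : 0 <= B.
  apply: addr_ge0 => //; apply: divr_ge0; last exact: ltW.
  by apply: mulr_ge0 => //; apply: sqr_ge0.
exists ((n.+1 * 1)%:R * B) => [|i]; first by rewrite mulr_ge0.
apply: nrm_le_entry => c j; rewrite (ord1 j).
have o : herm (h ^+ i *m z) v = 0.
  rewrite hermDr hermZr (axial_orthX i ax zx).
  by rewrite (axial_orthX i (axial_sym ax) zy) mulr0 addr0.
have := orth_pos_bound c vpos o; rewrite qfU; last exact: inUX.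
rewrite -ler_pdivlMr // /B; move: (_ / qf v) => t.
by move: (cabs (_ c 0)) => r H; nra.
Qed.

(** The conjugates of [k] by powers of [h] stay bounded: the component of [k *m y] along [y] grows
    like [m ^+ i], which the factor [m ^- i] from [invmx h ^+ i *m y] cancels, and the rest stays
    bounded. Two conjugates agree up to a scalar, so a power of [h] commutes projectively with [k]
    and fixes [k *m y]. *)
Lemma discrete_fixes_attracting S h k x y l m : PUsubgroup S -> pu_discrete S ->
  S h -> S k -> axial h x y l m -> cabs l < 1 -> fixes k x -> fixes k y.
Proof.
move=> Sg Sd Sh Sk ax l1 [kap ek]; have [S1 SU SM SV] := Sg.
have [hU nx ny xy hx hy _] := ax; have kU := SU _ Sk.
have [s [vpos _]] := plane_pos nx ny xy; set v := x + s *: y in vpos.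
have [a [b [z [ey zx zy]]]] := plane_decomp nx ny xy (k *m y).
have [Z Z0 HZ] := axial_orth_bounded ax zx zy.
pose D := cabs kap * nrm x + cabs s * (cabs a * nrm x + cabs b * nrm y + Z).
have [K HK] := nrm_le_of_image D vpos.
have hiU := inUV hU; have hu := inU_unit hU.
have lm := axial_lm ax.
have l0 : 0 <= cabs l := cabs_ge0 l.
pose q i := h ^+ i *m k *m invmx h ^+ i.
have Sq i : S (q i).
  exact: SM _ _ (SM _ _ (subgroupX i Sg Sh) Sk) (subgroupX i Sg (SV _ Sh)).
have qU i : inU (q i) by apply: SU.
have qD i : nrm (q i *m v) <= D.
  have [[x0 _] [y0 _]] := (nx, ny).
  have [L0 ehx] := eigen_inv hU x0 hx; have [M0 ehy] := eigen_inv hU y0 hy.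
  have -> : q i *m v = kap *: x +
     (s * m ^- i) *: ((a * l ^+ i) *: x + (b * m ^+ i) *: y + h ^+ i *m z).
    rewrite /q /v mulmxDr -scalemxAr -!mulmxA (eigenX i ehx) (eigenX i ehy).
    rewrite -!scalemxAr ek ey -!scalemxAr (eigenX i hx) !mulmxDr -!scalemxAr.
    rewrite (eigenX i hx) (eigenX i hy) !scalerA !exprVn; congr (_ + _).
    by rewrite mulrAC mulVf ?expf_neq0 // mul1r.
  apply: le_trans (nrmD _ _) _; rewrite !nrmZ lerD2l cabsM -mulrA.
  rewrite ler_wpM2l ?cabs_ge0 //.
  have mi : cabs (m ^- i) = cabs l ^+ i.
    rewrite cabsV cabsX -exprVn; congr (_ ^+ _).
    have m0 : cabs m != 0 by rewrite cabs_eq0.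
    by apply: (mulIf m0); rewrite lm mulVf.
  have li : 0 <= cabs l ^+ i <= 1 by rewrite exprn_ge0 // exprn_ile1 // ltW.
  have mm : cabs (m ^- i) * cabs (m ^+ i) = 1.
    by rewrite -cabsM mulVf ?expf_neq0 // cabs1.
  apply: le_trans (ler_wpM2l (cabs_ge0 _) (nrmD _ _)) _; rewrite mulrDr.
  apply: lerD; last first.
    apply: le_trans (_ : 1 * Z <= _); last by rewrite mul1r.
    by apply: ler_pM; rewrite ?cabs_ge0 ?nrm_ge0 // mi; case/andP: li.
  apply: le_trans (ler_wpM2l (cabs_ge0 _) (nrmD _ _)) _; rewrite mulrDr !nrmZ !cabsM.
  apply: lerD; last first.
    rewrite [leLHS](_ : _ = (cabs (m ^- i) * cabs (m ^+ i)) * (cabs b * nrm y)).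
      by rewrite mm mul1r.
    by ring.
  rewrite mi cabsX; case/andP: li; move: (cabs l ^+ i) => t t0 t1.
  have -> : t * (cabs a * t * nrm x) = (t * t) * (cabs a * nrm x) by ring.
  rewrite ler_piMl ?mulr_ge0 ?cabs_ge0 ?nrm_ge0 //; nra.
have [i [j [nu [ij E]]]] := discrete_pigeonhole Sg Sd Sq (fun i => HK _ (qU i) (qD i)).
set d := (j - i)%N; have d0 : (0 < d)%N by rewrite subn_gt0.
have Hd : h ^+ d *m k = nu *: (k *m h ^+ d).
  have ji : j = (i + d)%N by rewrite /d subnKC // ltnW.
  have : h ^+ d *m k *m invmx h ^+ d = nu *: k.
    have e1 : h ^+ j = h ^+ i *m h ^+ d by rewrite ji exprD.
    have e2 : invmx h ^+ j = invmx h ^+ d *m invmx h ^+ i by rewrite ji addnC exprD.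
    have i1 := mulmx_invX' i hu; have := congr1 (fun X => invmx h ^+ i *m X *m h ^+ i) E.
    rewrite /q {}e1 {}e2.
    move: i1; move: (h ^+ i) (invmx h ^+ i) (h ^+ d) (invmx h ^+ d) => p p' r r' pp.
    rewrite -scalemxAr -scalemxAl !mulmxA pp !mul1mx -!mulmxA pp.
    by rewrite !mulmx1.
  move/(congr1 (mulmx^~ (h ^+ d))); rewrite -mulmxA mulmx_invX' // mulmx1.
  by rewrite -scalemxAl.
have fk : fixes (h ^+ d) (k *m y).
  exists (nu * m ^+ d).
  by rewrite mulmxA Hd -scalemxAl -mulmxA (eigenX d hy) -scalemxAr scalerA.
(* So [k *m y] is on the line of [x] or of [y]; the former is excluded because [k] preserves the
   line of [x]. *)
case: (axial_fix (axialX ax d0) (closureU kU (null_closure ny)) fk).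
  move=> xky; case: xy; apply: (propU kU); apply: prop_trans xky.
  by apply: prop_sym; [exact: (unitary_neq0 kU (proj1 nx)) | exists kap].
by move=> [c e]; exists c.
Qed.

Lemma discrete_fixes_axis S h k x y l m : PUsubgroup S -> pu_discrete S ->
  S h -> S k -> axial h x y l m -> fixes k x -> fixes k y.
Proof.
move=> Sg Sd Sh Sk ax; have [S1 SU SM SV] := Sg.
have [l1|l1|l1] := ltgtP (cabs l) 1; last by have := ax_l ax; rewrite l1 eqxx.
  exact: (discrete_fixes_attracting Sg Sd Sh Sk ax l1).
apply: (discrete_fixes_attracting Sg Sd (SV _ Sh) Sk (axialV ax)).
by rewrite cabsV invf_lt1 // (lt_trans ltr01).
Qed.

End Discrete.

(** * Small elements of discrete subgroups *)

Lemma exp_unbounded (t e D : R) : 1 < t -> 0 < e -> exists j, D < t ^+ j * e.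
Proof.
move=> t1 e0; have bern j : 1 + j%:R * (t - 1) <= t ^+ j.
  elim: j => [|j IH]; first by rewrite mul0r addr0 expr0.
  rewrite exprS -natr1; have j0 : 0 <= j%:R :> R by rewrite ler0n.
  move: (j%:R) (t ^+ j) IH j0 => a b IH a0.
  have h1 : 0 <= a * (t - 1) ^+ 2 by rewrite mulr_ge0 ?sqr_ge0.
  have h2 : t * (1 + a * (t - 1)) <= t * b by rewrite ler_wpM2l //; lra.
  by lra.
have te : 0 < (t - 1) * e by rewrite mulr_gt0 // subr_gt0.
have := archi_boundP (normr_ge0 (D / ((t - 1) * e))).
set j := Num.bound _ => hj; exists j.
have : D < j%:R * ((t - 1) * e).
  by rewrite -ltr_pdivrMr //; apply: le_lt_trans hj; apply: ler_norm.
by have := bern j; move: (t ^+ j) (j%:R) => b a; nra.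
Qed.

(** The matrices [f A] represent the restrictions to [V] in the basis [row_base V]; they commute as
    well, and a common eigenvector of theirs is carried back to [V]. *)
Lemma common_eigenvector_in N (As : seq 'M[C]_N) (V : 'M_N) : (0 < \rank V)%N ->
  (forall A, A \in As -> stablemx V A) ->
  (forall A B, A \in As -> B \in As -> A *m B = B *m A) ->
  exists w : 'rV_N, [/\ w != 0, (w <= V)%MS &
    forall A, A \in As -> exists a, w *m A = a *: w].
Proof.
move=> V0 Vst Acomm; have [f fE] : exists f, forall A, A \in As ->
    f A *m row_base V = row_base V *m A.
  exists (fun A => row_base V *m A *m pinvmx (row_base V)) => A AA.
  by rewrite mulmxKpV // stablemx_row_base Vst.
have fM A B : A \in As -> B \in As -> f A *m f B *m row_base V = row_base V *m (A *m B).
  by move=> AA BB; rewrite -mulmxA fE // mulmxA fE // mulmxA.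
have [A' B'|w w0 wP] := @common_eigenvector C _ [seq f A | A <- As] V0.
  move=> /mapP[A AA ->] /mapP[B BB ->].
  apply/eqP; rewrite -subr_eq0 -(mulmx_free_eq0 _ (row_base_free V)) mulmxBl.
  by rewrite (fM A B AA BB) (fM B A BB AA) (Acomm A B AA BB) subrr.
exists (w *m row_base V); split.
- by rewrite mulmx_free_eq0 ?row_base_free.
- by rewrite mulmx_sub // eq_row_base.
move=> A AA; have /allP/(_ _ (map_f f AA))/sub_rVP[a e] := wP.
by exists a; rewrite -mulmxA -fE // mulmxA e scalemxAl.
Qed.

Section Small.
Variable n : nat.
Local Notation mat := 'M[C]_(n.+1).
Local Notation vec := 'cV[C]_(n.+1).
Implicit Types (A B X g h k : mat) (u v w x y z : vec) (a b l m : C) (S : mat -> Prop).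

Lemma herm_kermx u : forall z : 'rV[C]_(n.+1),
  (z <= kermx (adjm u *m Jmx n)^T)%MS = (herm z^T u == 0).
Proof.
move=> z; rewrite sub_kermx; have -> : z *m (adjm u *m Jmx n)^T = (herm z^T u)%:M.
  apply/matrixP=> i j; rewrite !ord1 [RHS]mxE eqxx /herm -[in LHS](trmxK z).
  by rewrite -trmx_mul mxE.
apply/eqP/eqP => [/matrixP/(_ 0 0)|->]; last by rewrite raddf0.
by rewrite !mxE eqxx.
Qed.

(** Induction on the rank of [V]. A common eigenvector [u] in [V] either has [qf u >= 0] and is the
    answer, or is negative; then its orthogonal complement in [V] is stable, has smaller rank and
    contains the projection of [p], which is still positive. Transposes appear because subspaces are
    row spaces. *)
Lemma stable_closure_eigenvector (As : seq mat) (V : mat) :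
  (forall A, A \in As -> inU A) ->
  (forall A B, A \in As -> B \in As -> A *m B = B *m A) ->
  (forall A, A \in As -> stablemx V A^T) ->
  (exists2 p : vec, (p^T <= V)%MS & 0 < qf p) ->
  exists2 v : vec, closure_vec v & forall A, A \in As -> fixes A v.
Proof.
move=> AU Acomm; move: {2}(\rank V) (leqnn (\rank V)) => r.
elim: r V => [|r IH] V rV Vst [p pV ppos].
  move: rV; rewrite leqn0 mxrank_eq0 => /eqP V0; move: pV ppos.
  rewrite V0 submx0 => /eqP/(congr1 trmx); rewrite trmxK trmx0 => ->.
  by rewrite qf0 ltxx.
have V0 : (0 < \rank V)%N.
  rewrite lt0n mxrank_eq0; apply: contraTneq ppos => V0.
  move: pV; rewrite V0 submx0 => /eqP/(congr1 trmx); rewrite trmxK trmx0 => ->.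
  by rewrite qf0 ltxx.
have [||w [w0 uV wP]] := @common_eigenvector_in _ [seq A^T | A <- As] V V0.
- by move=> _ /mapP[A AA ->]; apply: Vst.
- by move=> _ _ /mapP[A AA ->] /mapP[B BB ->]; rewrite -!trmx_mul Acomm.
pose u := w^T; have u0 : u != 0 by rewrite trmx_eq0.
have fu A : A \in As -> exists a, A *m u = a *: u.
  move=> AA; have [a e] := wP _ (map_f _ AA); exists a.
  by rewrite /u -[A]trmxK -trmx_mul e linearZ.
rewrite -[w]trmxK -/u in uV.
have [uq|uq] := leP 0 (qf u).
  by exists u; [apply/closure_vecP | move=> A /fu].
have hu0 : herm u u != 0.
  by rewrite herm_qf; apply/eqP => /complexI h; rewrite h ltxx in uq.
pose W := (V :&: kermx (adjm u *m Jmx n)^T)%MS.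
apply: (IH W).
- rewrite -ltnS; apply: leq_trans rV; rewrite (ltn_leqif (mxrank_leqif_sup _)) ?capmxSl //.
  apply/negP => /(submx_trans uV); rewrite sub_capmx => /andP[_].
  by rewrite herm_kermx trmxK (negbTE hu0).
- move=> A AA; have [a e] := fu A AA; have [a0 _] := eigen_inv (AU A AA) u0 e.
  rewrite sub_capmx; apply/andP; split.
    by apply: submx_trans (Vst A AA); apply: submxMr; apply: capmxSl.
  (* Since [A] preserves the form and [u] is an eigenvector, [herm (A *m z) u] is a fixed multiple
     of [herm z u]. *)
  have eK : A^T *m (adjm u *m Jmx n)^T = (Num.conj a^-1) *: (adjm u *m Jmx n)^T.
    rewrite -trmx_mul -[in LHS](scale1r u) -[1](mulVf a0) -scalerA -e.
    have -> : adjm (a^-1 *: (A *m u)) = Num.conj a^-1 *: (adjm u *m adjm A).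
      by rewrite -adjmM; apply/matrixP=> i j; rewrite !mxE rmorphM.
    rewrite -!scalemxAl linearZ /=; congr (_ *: _^T).
    by rewrite -[in RHS](AU A AA) !mulmxA.
  rewrite sub_kermx -mulmxA eK -scalemxAr; apply/eqP.
  suff -> : W *m (adjm u *m Jmx n)^T = 0 by rewrite scaler0.
  by apply/eqP; rewrite -sub_kermx capmxSr.
- pose t := herm p u / herm u u; exists (p - t *: u).
    rewrite sub_capmx herm_kermx trmxK hermDl hermNl hermZl mulfVK // subrr eqxx andbT.
    by rewrite linearB linearZ /= addmx_sub // -scaleNr scalemx_sub.
  have o : herm (p - t *: u) (t *: u) = 0.
    by rewrite hermZr hermDl hermNl hermZl mulfVK // subrr mulr0.
  have := qfD_orth o; rewrite subrK qfZ => e.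
  have := sqr_ge0 (cabs t); move: ppos; rewrite e; move: (cabs t ^+ 2) => c; nra.
Qed.

Lemma common_closure_eigenvector (As : seq mat) :
  (forall A, A \in As -> inU A) ->
  (forall A B, A \in As -> B \in As -> A *m B = B *m A) ->
  exists2 v : vec, closure_vec v & forall A, A \in As -> fixes A v.
Proof.
move=> AU Ac; apply: (@stable_closure_eigenvector As 1%:M) => //.
  by move=> A _; apply: submx1.
exists (delta_mx 0 0); first exact: submx1.
rewrite /qf !mxE !eqxx cabs1 expr1n big1 ?subr0 // => i _.
by rewrite !mxE /= cabs0 expr0n.
Qed.

(* Radius of a Zassenhaus neighbourhood of 1 for the norm [nrm]. *)
Definition zradius : R := (4 * n.+2%:R ^+ 2)^-1.

(** The third bound yields the factor 1/2 in [commutator_near], the fourth the nonzero trace in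
    [commutator_id_commute]. *)
Lemma zradius_bounds : [/\ 0 < zradius, zradius < 1 / 2,
  2 * zradius * n.+2%:R ^+ 2 = 1 / 2 & zradius * n.+2%:R + zradius < 1].
Proof.
rewrite /zradius; have N2 : 2 <= n.+2%:R :> R by rewrite ler_nat.
move: (n.+2%:R : R) N2 => N N2.
have N0 : 0 < 4 * N ^+ 2 by nra.
have e : (4 * N ^+ 2)^-1 * (4 * N ^+ 2) = 1 by rewrite mulVf // gt_eqF.
have z0 : 0 < (4 * N ^+ 2)^-1 by rewrite invr_gt0.
move: (4 * N ^+ 2)^-1 e z0 => z e z0.
have zN : 0 < z * N by rewrite mulr_gt0 //; lra.
have e' : (z * N) * (4 * N) = 1 by rewrite -[RHS]e; ring.
have zN2 : z * N <= 1 / 8 by nra.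
split=> //; [nra | lra | nra].
Qed.

Lemma nrm_near1 A : nrm (A - 1%:M) <= zradius -> nrm A <= n.+2%:R.
Proof.
move=> h; have [_ z2 _ _] := zradius_bounds.
rewrite -[A](subrK 1%:M); apply: le_trans (nrmD _ _) _; rewrite nrm1 -[n.+2%:R]natr1.
lra.
Qed.

(** [A *m X - X *m A] is also the additive commutator of [A - 1%:M] and [X - 1%:M], hence
    quadratically small. *)
Lemma commutator_near A X : inU A -> inU X ->
  nrm (A - 1%:M) <= zradius -> nrm (X - 1%:M) <= zradius ->
  nrm (A *m X *m invmx A *m invmx X - 1%:M) <= nrm (A - 1%:M) / 2.
Proof.
move=> AU XU nA nX; have [z0 z1 z2 _] := zradius_bounds.
have e : A *m X *m invmx A *m invmx X - 1%:M =
    ((A - 1%:M) *m (X - 1%:M) - (X - 1%:M) *m (A - 1%:M)) *m (invmx A *m invmx X).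
  have -> : (A - 1%:M) *m (X - 1%:M) - (X - 1%:M) *m (A - 1%:M) = A *m X - X *m A.
    rewrite !mulmxBl !mulmxBr !mulmx1 !mul1mx.
    move: (A *m X) (X *m A) (1%:M) => P Q E.
    by apply/matrixP => i j; rewrite !mxE; ring.
  rewrite mulmxBl; congr (_ - _); first by rewrite !mulmxA.
  by rewrite mulmxA -(mulmxA X) mulmxV ?inU_unit // mulmx1 mulmxV ?inU_unit.
rewrite e; apply: le_trans (nrmM _ _) _.
apply: le_trans (ler_pM (nrm_ge0 _) (nrm_ge0 _) (nrmB _ _) (nrmM _ _)) _.
rewrite !nrm_invmx //; have nA' := nrm_near1 nA; have nX' := nrm_near1 nX.
apply: le_trans (_ : (nrm (A - 1%:M) * zradius + zradius * nrm (A - 1%:M)) *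
   (n.+2%:R * n.+2%:R) <= _).
  apply: ler_pM; rewrite ?addr_ge0 ?mulr_ge0 ?nrm_ge0 //.
    apply: lerD; apply: le_trans (nrmM _ _) _; first by rewrite ler_wpM2l ?nrm_ge0.
    by rewrite ler_wpM2r ?nrm_ge0.
  by apply: ler_pM; rewrite ?nrm_ge0.
rewrite (_ : _ * _ = nrm (A - 1%:M) * (2 * zradius * n.+2%:R ^+ 2)); last by ring.
by rewrite z2 mulrA mulr1.
Qed.

Lemma cabs_mxtrace A : cabs (\tr A) <= nrm A.
Proof.
apply: le_trans (cabs_sum _ _ _) _; apply: ler_sum => i _.
by rewrite (bigD1 i) //= lerDl; apply: sumr_ge0 => *; apply: cabs_ge0.
Qed.

(* Comparing traces in [A X = lam X A]: the trace of [X A], a matrix near 1,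
   is nonzero, so a projectively trivial commutator is trivial. *)
Lemma commutator_id_commute A X : inU A -> inU X ->
  nrm (A - 1%:M) <= zradius -> nrm (X - 1%:M) <= zradius ->
  is_id (A *m X *m invmx A *m invmx X) -> A *m X = X *m A.
Proof.
move=> AU XU nA nX /is_idP[lam _ e]; have [z0 z1 _ z3] := zradius_bounds.
have e' : A *m X = lam *: (X *m A).
  have := congr1 (fun Y => Y *m (X *m A)) e; rewrite /= mul_scalar_mx => <-.
  rewrite !mulmxA -(mulmxA _ (invmx X)) mulVmx ?inU_unit // mulmx1.
  by rewrite -(mulmxA _ (invmx A)) mulVmx ?inU_unit // mulmx1.
suff : lam = 1 by move=> l1; rewrite e' l1 scale1r.
have t0 : \tr (X *m A) != 0.
  apply/eqP => t0; have := cabs_mxtrace (X *m A - 1%:M).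
  rewrite linearB /= t0 sub0r cabsN mxtrace1.
  have -> : cabs n.+1%:R = n.+1%:R by rewrite -(cabs_real (ler0n _ _)) rmorph_nat.
  apply/negP; rewrite -ltNge.
  have -> : X *m A - 1%:M = (X - 1%:M) *m A + (A - 1%:M).
    by rewrite mulmxBl mul1mx addrA subrK.
  apply: le_lt_trans (nrmD _ _) _.
  apply: le_lt_trans (lerD (nrmM _ _) nA) _.
  apply: le_lt_trans (_ : zradius * n.+2%:R + zradius < _).
    by rewrite lerD2r; apply: ler_pM; rewrite ?nrm_ge0 ?nrm_near1.
  by apply: lt_le_trans z3 _; rewrite ler1n.
apply: (mulIf t0); rewrite mul1r -mxtraceZ -e'.
exact: mxtrace_mulC.
Qed.

(** Take [k] such that every element of [S] at most half as far from 1 is trivial. The commutators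
    of [k] with elements near 1 are that close. *)
Lemma exists_small_central S k' : PUsubgroup S -> pu_discrete S ->
  S k' -> ~ is_id k' -> nrm (k' - 1%:M) <= zradius ->
  exists k, [/\ S k, ~ is_id k, nrm (k - 1%:M) <= nrm (k' - 1%:M) &
    forall X, S X -> nrm (X - 1%:M) <= zradius -> k *m X = X *m k].
Proof.
move=> Sg Sd Sk' nid' near'; have [S1 SU SM SV] := Sg.
have [k [[Sk nid near] min]] : exists k,
    [/\ S k, ~ is_id k & nrm (k - 1%:M) <= nrm (k' - 1%:M)] /\
    forall B, S B -> nrm (B - 1%:M) <= nrm (k - 1%:M) / 2 -> is_id B.
  (* Otherwise halving never stops and brings nontrivial elements arbitrarily close to 1, against
     discreteness. *)
  apply: NNPP => H.
  have [d d0 Hd] := discrete_id Sg Sd.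
  have chain i : exists k, [/\ S k, ~ is_id k & nrm (k - 1%:M) <= nrm (k' - 1%:M)] /\
      nrm (k - 1%:M) * 2 ^+ i <= nrm (k' - 1%:M).
    elim: i => [|i [k [[Sk nid near] IH]]]; first by exists k'; rewrite expr0 mulr1.
    apply: NNPP => H'; apply: H; exists k; split=> // B SB Bk; apply: NNPP => nidB.
    apply: H'; exists B; have := nrm_ge0 (k - 1%:M).
    move=> *; split; first by split=> //; lra.
    apply: le_trans IH; rewrite exprS mulrA ler_wpM2r ?exprn_ge0 //; lra.
  have [i Hi] := @exp_unbounded 2 d (nrm (k' - 1%:M)) (ltr1n _ _) d0.
  have [k [[Sk nid near] ki]] := chain i; apply: nid; apply: Hd => //.
  have p0 : 0 < 2 ^+ i :> R by rewrite exprn_gt0.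
  by rewrite -(ltr_pM2r p0); apply: le_lt_trans ki _; rewrite mulrC.
exists k; split=> // X SX nX; have nk := le_trans near near'.
have kU := SU _ Sk; have XU := SU _ SX.
apply: commutator_id_commute => //; apply: min; last exact: commutator_near.
exact: SM _ _ (SM _ _ (SM _ _ Sk SX) (SV _ Sk)) (SV _ SX).
Qed.

(** By Cayley-Hamilton, [g ^+ j] is a polynomial of degree at most [n] in [g]. *)
Lemma powers_kill g (M : mat) v : (forall j, (j <= n)%N -> M *m (g ^+ j *m v) = 0) ->
  forall j, M *m (g ^+ j *m v) = 0.
Proof.
move=> H j; pose chi := char_poly g.
have -> : g ^+ j = horner_mx g ('X^j %% chi).
  transitivity (horner_mx g 'X^j); first by rewrite rmorphXn /= horner_mx_X.
  by rewrite {1}(divp_eq 'X^j chi) rmorphD rmorphM /= Cayley_Hamilton mulr0 add0r.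
have sz : (size ('X^j %% chi)%R <= n.+1)%N.
  by rewrite -ltnS -(size_char_poly g) ltn_modp -size_poly_eq0 size_char_poly.
move: ('X^j %% chi) sz => p sz.
rewrite -[p]coefK poly_def linear_sum /= mulmx_suml mulmx_sumr big1 // => i _.
rewrite linearZ /= rmorphXn /= horner_mx_X -scalemxAl -scalemxAr H ?scaler0 //.
by rewrite -ltnS; apply: leq_trans (ltn_ord i) sz.
Qed.

(** The term of [M *m (g ^+ j *m v)] along [x] has norm [cabs l ^+ j * (cabs a * nrm (M *m x))],
    while the others stay bounded in [j]. *)
Lemma expanding_kill g (M : mat) x y l m v a b z : axial g x y l m -> 1 < cabs l ->
  v = a *: x + b *: y + z -> a != 0 -> herm z x = 0 -> herm z y = 0 ->
  (forall j, M *m (g ^+ j *m v) = 0) -> M *m x = 0.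
Proof.
move=> ax l1 ev a0 zx zy H; have [gU nx ny xy gx gy _] := ax.
have [Z Z0 HZ] := axial_orth_bounded ax zx zy.
apply: nrm_eq0; apply/eqP; rewrite eq_le nrm_ge0 andbT leNgt; apply/negP => Mx0.
have e0 : 0 < cabs a * nrm (M *m x) by rewrite mulr_gt0 // cabs_gt0.
have [j] := exp_unbounded (cabs b * nrm (M *m y) + nrm M * Z) l1 e0.
apply/negP; rewrite -leNgt.
have := H j; rewrite ev !mulmxDr -!scalemxAr (eigenX j gx) (eigenX j gy).
rewrite -!scalemxAr !scalerA -addrA => /eqP; rewrite addr_eq0 => /eqP.
move/(congr1 (@nrm _ _)); rewrite nrmN nrmZ cabsM cabsX => e.
rewrite mulrA [_ * cabs a]mulrC e; apply: le_trans (nrmD _ _) _; apply: lerD.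
  rewrite nrmZ cabsM cabsX ler_wpM2r ?nrm_ge0 // ler_piMr ?cabs_ge0 //.
  apply: exprn_ile1; first exact: cabs_ge0.
  rewrite -(ler_pM2l (lt_trans ltr01 l1)) mulr1 (axial_lm ax); exact: ltW.
by apply: le_trans (nrmM _ _) _; rewrite ler_wpM2l ?nrm_ge0.
Qed.

Lemma conj_near h k j : inU h ->
  nrm (h ^+ j *m k *m invmx h ^+ j - 1%:M) <= nrm h ^+ (2 * j) * nrm (k - 1%:M).
Proof.
move=> hU; have -> : h ^+ j *m k *m invmx h ^+ j - 1%:M =
    h ^+ j *m (k - 1%:M) *m invmx h ^+ j.
  by rewrite mulmxBr mulmxBl mulmx1 mulmx_invX // inU_unit.
(* Positive exponents only: the norm of the identity is [n.+1], not 1. *)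
have pw A i : inU A -> nrm (A ^+ i.+1) <= nrm A ^+ i.+1.
  move=> AU; elim: i => [|i IH]; first by rewrite !expr1.
  rewrite exprS [leRHS]exprS; apply: le_trans (nrmM _ _) _.
  by rewrite ler_wpM2l ?nrm_ge0.
case: j => [|j]; first by rewrite muln0 !expr0 mul1mx mulmx1 mul1r.
apply: le_trans (nrmM _ _) _.
apply: le_trans (ler_pM (nrm_ge0 _) (nrm_ge0 _) (nrmM _ _) (pw _ _ (inUV hU))) _.
rewrite nrm_invmx // mulrAC ler_wpM2r ?nrm_ge0 // mul2n -addnn exprD.
by rewrite ler_wpM2r ?exprn_ge0 ?nrm_ge0 // pw.
Qed.

(** The conjugates [K j] commute, so they share an eigenvector [v] in the closure. Either [v] is an
    end of the axis, or [k] acts by one scalar on all the vectors [invmx h ^+ j *m v], whose lines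
    accumulate at such an end. *)
Lemma small_central_fixes_axis S h k x y l m : PUsubgroup S -> pu_discrete S ->
  S h -> S k -> axial h x y l m ->
  nrm h ^+ (2 * n.+2) * nrm (k - 1%:M) <= zradius ->
  (forall X, S X -> nrm (X - 1%:M) <= zradius -> k *m X = X *m k) ->
  fixes k x /\ fixes k y.
Proof.
move=> Sg Sd Sh Sk ax small central; have [S1 SU SM SV] := Sg.
suff : fixes k x \/ fixes k y.
  case=> f; split=> //; first exact: (discrete_fixes_axis Sg Sd Sh Sk ax f).
  exact: (discrete_fixes_axis Sg Sd Sh Sk (axial_sym ax) f).
have [hU nx ny xy hx hy _] := ax; have kU := SU _ Sk; have hu := inU_unit hU.
pose K j := h ^+ j *m k *m invmx h ^+ j.
have SK j : S (K j).
  exact: SM _ _ (SM _ _ (subgroupX j Sg Sh) Sk) (subgroupX j Sg (SV _ Sh)).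
have nearK j : (j <= n.+2)%N -> nrm (K j - 1%:M) <= zradius.
  move=> jn; apply: le_trans (conj_near k j hU) _; apply: le_trans small.
  rewrite ler_wpM2r ?nrm_ge0 //; apply: ler_weXn2l; first exact: nrm_inU_ge1.
  by rewrite leq_mul2l.
have Kadd i d : K (i + d)%N = h ^+ i *m K d *m invmx h ^+ i.
  have e : invmx h ^+ (i + d) = invmx h ^+ d *m invmx h ^+ i by rewrite addnC exprD.
  by rewrite /K e exprD -mulmxE !mulmxA.
(* Undoing the conjugation by [h ^+ i] reduces this to [k] commuting with [K (j - i)], which is near
   1. *)
have comm i j : (i <= j)%N -> (j <= n.+2)%N -> K i *m K j = K j *m K i.
  move=> ij jn; rewrite -(subnKC ij) Kadd; set d := (j - i)%N.
  have := central _ (SK d) (nearK d (leq_trans (leq_subr _ _) jn)).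
  have eK : K i = h ^+ i *m k *m invmx h ^+ i by [].
  rewrite eK; move: (h ^+ i) (invmx h ^+ i) (mulmx_invX' i hu) (K d) => p p' pp t e.
  transitivity (p *m (k *m (p' *m p) *m t) *m p'); first by rewrite !mulmxA.
  by rewrite pp mulmx1 e -(mulmx1 t) -pp !mulmxA -!(mulmxA _ p' p) pp !mulmx1.
(* Indices run from 0 to [n.+2]: [powers_kill] uses those up to [n], and comparing eigenvalues needs
   three points even for small [n]. *)
pose As := [seq K j | j <- iota 0 n.+3].
have AsP A : A \in As -> exists2 j, (j <= n.+2)%N & A = K j.
  by case/mapP=> j; rewrite mem_iota add0n ltnS => jn ->; exists j.
have KAs j : (j <= n.+2)%N -> K j \in As.
  by move=> jn; apply: map_f; rewrite mem_iota add0n ltnS.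
have [|A B /AsP[i ile ->] /AsP[j jle ->]|v cv fv] := @common_closure_eigenvector As.
- by move=> A /AsP[j _ ->]; apply: SU.
- by case/orP: (leq_total i j) => ij; [|symmetry]; apply: comm.
pose w j := invmx h ^+ j *m v.
have hiU := inUV hU.
have cw j : closure_vec (w j) by apply: closureU => //; apply: inUX.
have ew j : (j <= n.+2)%N -> exists a, k *m w j = a *: w j.
  move=> jn; have [a e] := fv _ (KAs j jn); exists a.
  have := congr1 (mulmx (invmx h ^+ j)) e; rewrite /K !mulmxA mulmx_invX' // mul1mx.
  by rewrite /w scalemxAr.
have [vx|vx] := classic (proportional x v).
  left; have [a e] := ew 0 isT; rewrite /w expr0 mul1mx in e.
  apply: (fixes_prop (ex_intro _ a e)); apply: prop_sym vx.
  by case: cv.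
have [vy|vy] := classic (proportional y v).
  right; have [a e] := ew 0 isT; rewrite /w expr0 mul1mx in e.
  apply: (fixes_prop (ex_intro _ a e)); apply: prop_sym vy.
  by case: cv.
have ax' := axialV ax.
(* If [w i] and [w j] were proportional, a power of [invmx h] would fix [w i], putting it, and
   therefore [v], at an end of the axis. *)
have nw i j : (i < j)%N -> ~ proportional (w i) (w j).
  move=> ij [c e]; have d0 : (0 < j - i)%N by rewrite subn_gt0.
  have f : fixes (invmx h ^+ (j - i)) (w i).
    by exists c; rewrite -e /w mulmxA mulmxE -exprD subnK // ltnW.
  have back p a : invmx h *m p = a *: p -> p != 0 -> proportional p (w i) -> proportional p v.
    move=> ep p0 [t et]; have [a0 ep'] := eigen_inv hiU p0 ep; exists (t * (a^-1) ^+ i).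
    rewrite invmxK in ep'; rewrite -scalerA -(eigenX i ep') scalemxAr -et /w mulmxA.
    by rewrite mulmx_invX // mul1mx.
  have [x0 _] := nx; have [y0 _] := ny.
  case: (axial_fix (axialX ax' d0) (cw i) f) => pw.
    exact: vx (back _ _ (ax_hx ax') x0 pw).
  exact: vy (back _ _ (ax_hy ax') y0 pw).
have nw' i j : i != j -> herm (w i) (w j) != 0.
  rewrite neq_ltn => /orP[] ij.
    by apply: closure_herm_neq0 => //; apply: nw.
  apply/eqP => /(herm_eq0C) h0; have /eqP[] := closure_herm_neq0 (cw j) (cw i) (nw _ _ ij).
  exact: h0.
have [al e0] := ew 0 isT.
have eal j : (j <= n.+2)%N -> k *m w j = al *: w j.
  move=> jn; have [-> //|j0] := eqVneq j 0%N.
  have [a e] := ew j jn; suff -> : al = a by [].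
  (* The eigenvalues at [w 0] and [w j] are both determined by the one at a third point [w t]. *)
  have [t tn /andP[t0 tj]] : exists2 t, (t <= n.+2)%N & (0%N != t) && (j != t).
    by have [->|j1] := eqVneq j 1%N; [exists 2 | exists 1%N].
  have [c ec] := ew t tn.
  have h1 := eigen_herm kU e0 ec (nw' _ _ t0); have h2 := eigen_herm kU e ec (nw' _ _ tj).
  have c0 : Num.conj c != 0 by apply: contra_eq_neq h1 => ->; rewrite mulr0 eq_sym oner_neq0.
  by apply: (mulIf c0); rewrite h1.
pose M := k - al%:M.
have fM p : M *m p = 0 -> fixes k p.
  by rewrite mulmxBl mul_scalar_mx => /subr0_eq e; exists al.
have kill : forall j, M *m (invmx h ^+ j *m v) = 0.
  apply: powers_kill => j jn; rewrite mulmxBl mul_scalar_mx eal ?subrr //.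
  by apply: leq_trans jn _; rewrite -addn2 leq_addr.
have [a [b [z [ev zx zy]]]] := plane_decomp nx ny xy v.
have a0 : a != 0.
  apply/eqP => a0; apply: vy; exists b.
  have z0 : z = 0.
    by apply: (@plane_half _ x y nx ny xy b) => //; rewrite ev a0 scale0r add0r in cv.
  by rewrite ev a0 z0 scale0r add0r addr0.
have b0 : b != 0.
  apply/eqP => b0; apply: vx; exists a.
  have z0 : z = 0.
    apply: (@plane_half _ y x ny nx (nprop_sym nx xy) a) => //.
    by rewrite ev b0 scale0r addr0 in cv.
  by rewrite ev b0 z0 scale0r !addr0.
(* [invmx h] expands exactly one of [x] and [y], and [M] vanishes on that one. *)
have [l1|l1|l1] := ltgtP (cabs l^-1) 1; last by have := ax_l ax'; rewrite l1 eqxx.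
  have ev' : v = b *: y + a *: x + z by rewrite ev [a *: x + _]addrC.
  right; apply: fM; apply: (expanding_kill (axial_sym ax') _ ev' b0 zy zx kill).
  have := axial_lm ax'; have := cabs_ge0 m^-1; move: l1 (cabs_ge0 l^-1).
  move: (cabs l^-1) (cabs m^-1) => p r; nra.
by left; apply: fM; exact: (expanding_kill ax' l1 ev a0 zx zy kill).
Qed.

End Small.

(** * The discreteness criterion *)

Lemma minr_le_l (r t : R) : Num.min r t <= r.
Proof. by rewrite ge_min lexx. Qed.

Section Criterion.
Variable n : nat.
Local Notation mat := 'M[C]_(n.+1).
Local Notation vec := 'cV[C]_(n.+1).
Implicit Types (A B X f g h k : mat) (u v w x y z p : vec) (a b l m : C).
Implicit Types (G S : mat -> Prop) (d e : R).

(** Pairing with [p] identifies the eigenvalues at [x] and [y]; pairing [x] with [y] then gives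
    modulus 1. *)
Lemma three_fixed_eigenvalue A x y p : inU A ->
  null_vec x -> null_vec y -> null_vec p ->
  ~ proportional x y -> ~ proportional x p -> ~ proportional y p ->
  fixes A x -> fixes A y -> fixes A p ->
  exists al, [/\ cabs al = 1, A *m x = al *: x & A *m y = al *: y].
Proof.
move=> AU nx ny np xy xp yp [a ea] [b eb] [c ec].
have nz := fun u w (nu : null_vec u) (nw : null_vec w) =>
  closure_herm_neq0 (null_closure nu) (null_closure nw).
have h1 := eigen_herm AU ea eb (nz _ _ nx ny xy).
have h2 := eigen_herm AU ea ec (nz _ _ nx np xp).
have h3 := eigen_herm AU eb ec (nz _ _ ny np yp).
have c0 : Num.conj c != 0 by apply: contra_eq_neq h2 => ->; rewrite mulr0 eq_sym oner_neq0.
have ab : a = b by apply: (mulIf c0); rewrite h2.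
exists a; split=> //; last by rewrite ab.
have := congr1 cabs h1; rewrite -ab cabsM cabsJ cabs1 -expr2 => /eqP.
by rewrite sqrp_eq1 ?cabs_ge0 // => /eqP.
Qed.

Lemma scalar_plane_infinite_bfix A x y al : null_vec x -> null_vec y ->
  ~ proportional x y -> A *m x = al *: x -> A *m y = al *: y -> infinite_bfix A.
Proof.
move=> nx ny xy ex ey s; pose c := herm x y.
have c0 : c != 0 by apply: closure_herm_neq0 => //; apply: null_closure.
(* With this factor [herm x (r t *: y)] is purely imaginary, which makes [x + r t *: y] null. *)
pose r (t : nat) : C := t%:R * ('i%C * c); pose v t := x + r t *: y.
have r_inj : injective r.
  move=> t t' /mulIf; rewrite mulf_neq0 // => [/(_ isT)/eqP|].
    by rewrite eqr_nat => /eqP.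
  by apply/eqP => /(congr1 (@complex.Im _)) /= /eqP; rewrite oner_eq0.
have v0 t : v t != 0.
  apply/eqP => /eqP; rewrite addr_eq0 => /eqP e; have [y0 _] := ny; have [x0 _] := nx.
  case: xy; apply: (prop_sym x0); exists (- r t); by rewrite scaleNr -e.
have vn t : null_vec (v t).
  apply/null_vecP; split=> //; apply: complexI; rewrite -herm_qf /v.
  have [_ qx] := nx; have [_ qy] := ny.
  rewrite hermDl !hermDr !hermZl !hermZr qx qy (hermC x y) -/c /r !rmorphM /=.
  have -> : Num.conj 'i%C = - 'i%C :> C by apply/eqP; rewrite eq_complex /= oppr0 !eqxx.
  by rewrite rmorph_nat; ring.
have vuniq w t t' : proportional w (v t) -> proportional w (v t') -> t = t'.
  move=> [a ea] [b eb]; apply: r_inj.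
  have a0 : a != 0 by apply: contraNneq (v0 t) => a0; rewrite ea a0 scale0r.
  have e : v t' = (b / a) *: v t by rewrite eb ea scalerA mulfVK.
  have [] := @plane_coord _ x y 1 (r t') 0 (b / a) ((b / a) * r t) 0 nx ny xy
    (herm0l _) (herm0l _) (herm0l _) (herm0l _).
    by rewrite !addr0 scale1r -[LHS]/(v t') e scalerDr scalerA.
  by move=> <- ->; rewrite mul1r.
(* Each [w] in [s] represents at most one of the points [v t], so all large [t] avoid the list. *)
have [T HT] : exists T, forall t, (T <= t)%N -> forall w, w \in s -> ~ proportional w (v t).
  elim: s => [|w s [T IH]]; first by exists 0%N.
  have [[t0 pt0]|no] := classic (exists t, proportional w (v t)).
    exists (maxn T t0.+1) => t; rewrite geq_max => /andP[Tt tt w'].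
    rewrite inE => /orP[/eqP->|/IH]; last exact.
    by move=> /(vuniq _ _ _ pt0) e; rewrite e ltnn in tt.
  exists T => t Tt w'; rewrite inE => /orP[/eqP->|/IH]; last exact.
  by move=> pw; apply: no; exists t.
exists (v T); split; last exact: HT.
split=> //; exists al.
by rewrite mulmxDr -scalemxAr ex ey scalerDr !scalerA mulrC.
Qed.

(** * Neighbourhoods of the identity in PU(1,n) *)

Definition near1 g d := exists2 lam : C, cabs lam = 1 & nrm (lam *: g - 1%:M) < d.

Lemma pu_near_sym g d : pu_near g 1%:M d -> pu_near 1%:M g d.
Proof.
move=> [lam [l1 near]]; have lam0 : lam != 0 by rewrite -normr_eq0 l1 oner_neq0.
exists lam^-1; rewrite normfV l1 invr1; split=> // i j.
rewrite -[X in _ - X](mulKf lam0) -mulrBr normrM normfV l1 invr1 mul1r distrC.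
exact: near.
Qed.

Lemma near1_le g d e : d <= e -> near1 g d -> near1 g e.
Proof. by move=> de [lam l1 h]; exists lam => //; apply: lt_le_trans de. Qed.

Lemma near1_pu_near g d : near1 g d -> pu_near g 1%:M d.
Proof.
move=> [lam /norm1_cabs l1 h]; exists lam; split=> // i j.
rewrite cabsE ltcR; apply: le_lt_trans h.
by have := nrm_entry (lam *: g - 1%:M) i j; rewrite !mxE.
Qed.

Lemma near1_proj_eq g g' d : proj_eq g g' -> near1 g' d -> near1 g d.
Proof.
move=> [mu [/norm1_cabs m1 ->]] [lam l1 h]; exists (lam * mu); first by rewrite cabsM l1 m1 mulr1.
by rewrite -scalerA.
Qed.

(** All entries are compared with [g 0 0], so the scalars [lam] for different [d] never have to
    converge. *)
Lemma near1_is_id g : inU g -> (forall d, 0 < d -> near1 g d) -> is_id g.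
Proof.
move=> gU H; apply: (@inU_scalar_id _ (g 0 0)) => //.
have small (r : R) : 0 <= r -> (forall d, 0 < d -> r < d) -> r = 0.
  by move=> r0 h; apply/eqP; rewrite eq_le r0 andbT leNgt; apply/negP => /h; rewrite ltxx.
apply/matrixP => i j; apply/eqP; rewrite -subr_eq0 -cabs_eq0; apply/eqP.
apply: small (cabs_ge0 _) _ => d d0.
have [lam l1 h] := H _ (divr_gt0 d0 (ltr0n _ 2)).
rewrite -[cabs _]mul1r -l1 -cabsM [X in _ - X]mxE.
have hij : cabs (lam * g i j - (i == j)%:R) < d / 2.
  by have := le_lt_trans (nrm_entry _ i j) h; rewrite !mxE.
have h00 : cabs (lam * g 0 0 - 1) < d / 2.
  by have := le_lt_trans (nrm_entry _ 0 0) h; rewrite !mxE.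
have [ij|ij] := eqVneq i j; rewrite ?ij ?eqxx ?(negbTE ij) in hij *.
  have -> : lam * (g j j - g 0 0 *+ true) = (lam * g j j - 1) - (lam * g 0 0 - 1).
    by rewrite mulr1n; ring.
  by apply: le_lt_trans (cabsD _ _) _; rewrite cabsN; move: hij h00; rewrite /=; lra.
by rewrite mulr0n subr0; move: hij; rewrite mulr0n subr0; lra.
Qed.

Lemma gen2_subgroup A B : inU A -> inU B -> PUsubgroup (gen2 A B).
Proof.
move=> AU BU; split; try by constructor.
move=> X; elim=> // {X} => [|X Y _ XU _ YU|X _ XU]; [exact: inU1|exact: inUM|exact: inUV].
Qed.

Lemma gen2_sub G A B X : PUsubgroup G -> G A -> G B -> gen2 A B X -> G X.
Proof.
move=> [G1 _ GM GV] GA GB; elim=> // {X} => [X Y _ GX _ GY|X _ GX].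
  exact: GM.
exact: GV.
Qed.

Lemma cabs_herm z w : cabs (herm z w) <= nrm z * nrm w.
Proof.
rewrite /herm -mulmxA; apply: le_trans (nrm_entry _ _ _) _.
apply: le_trans (nrmM _ _) _.
by rewrite nrm_adjm nrm_Jl mulrC.
Qed.

(** * Elements near the identity and the axis of a loxodromic element *)

Section Axis.
Variables (G : mat -> Prop) (h : mat) (x y : vec) (l m : C).
Hypotheses (hG : PUsubgroup G) (hh : G h) (ax : axial h x y l m).
Hypothesis (gen2_discrete : forall A B, G A -> G B -> loxodromic A -> loxodromic B ->
     pu_discrete (gen2 A B)).

Definition third_fixed g := exists p, [/\ null_vec p, ~ proportional x p,
  ~ proportional y p & fixes g p].

(** By [three_fixed_eigenvalue] such an element is scalar on the span of [x] and [y]; it fixes every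
    point of the chain through them, the boundary of a complex line. *)
Definition chain_fixer g := [/\ stab2 G x y g, third_fixed g & ~ is_id g].

(** [g *m h] has the same axis as [h], so [g] lies in a discrete group generated by two loxodromic
    elements; it also fixes a positive vector of the plane. *)
Lemma chain_fixer_finite g : chain_fixer g -> finite_order g /\ infinite_bfix g.
Proof.
move=> [[Gg fx fy] [p [np xp yp fp]] nid]; have [_ GU GM _] := hG.
have gU := GU _ Gg; have [hU nx ny xy hx hy hl] := ax.
have [al [al1 ex ey]] := three_fixed_eigenvalue gU nx ny np xy xp yp fx fy fp.
split; last exact: scalar_plane_infinite_bfix ex ey.
have ax2 : axial (g *m h) x y (l * al) (m * al).
  split=> //; first exact: inUM.
  - by rewrite -mulmxA hx -scalemxAr ex scalerA.
  - by rewrite -mulmxA hy -scalemxAr ey scalerA.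
  - by rewrite cabsM al1 mulr1.
have Sd : pu_discrete (gen2 h (g *m h)).
  by apply: gen2_discrete => //; [exact: GM | exact: axial_loxodromic ax |
    exact: axial_loxodromic ax2].
have Sg : PUsubgroup (gen2 h (g *m h)) by apply: gen2_subgroup => //; apply: inUM.
have Sk : gen2 h (g *m h) g.
  rewrite -[X in gen2 _ _ X](mulmx1 g) -(mulmxV (inU_unit hU)) mulmxA.
  by apply: gen2_mul; [apply: gen2_B | apply: gen2_inv; apply: gen2_A].
have [s [vpos _]] := plane_pos nx ny xy.
apply: (elliptic_finite_order Sg Sd Sk vpos); exists al.
by rewrite mulmxDr -scalemxAr ex ey scalerDr !scalerA mulrC.
Qed.

(** Without a gap, nontrivial elements of this kind exist arbitrarily near 1, and a sequence
    forbidden by Condition A can be extracted. *)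
Lemma conditionA_gap : conditionA (stab2 G x y) ->
  exists2 d, 0 < d & forall g, stab2 G x y g -> third_fixed g -> near1 g d -> is_id g.
Proof.
move=> cA; apply: NNPP => H; apply: cA.
have [_ GU _ _] := hG.
have [sel Hsel] : exists sel : R -> mat, forall d, 0 < d ->
    chain_fixer (sel d) /\ near1 (sel d) d.
  apply: (functional_choice (fun d g => 0 < d -> chain_fixer g /\ near1 g d)) => d.
  have [d0|d0] := ltP 0 d; last by exists 1%:M.
  apply: NNPP => H'; apply: H; exists d => // g sg tg ng; apply: NNPP => nid.
  by apply: H'; exists g.
have [gap Hgap] : exists gap : mat -> R, forall g, 0 < gap g /\
    (chain_fixer g -> ~ near1 g (gap g)).
  apply: (functional_choice (fun g d => 0 < d /\ (chain_fixer g -> ~ near1 g d))) => g.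
  apply: NNPP => H'; have [cg|ncg] := classic (chain_fixer g); last first.
    by apply: H'; exists 1; split=> // /ncg.
  have [[Gg _ _] _ nid] := cg; apply: nid; apply: near1_is_id; first exact: GU.
  move=> d d0; apply: NNPP => nn; apply: H'; by exists d.
(* Each radius excludes the element chosen at the previous one, so the terms are distinct, and is at
   most half the previous radius, so they converge to 1. *)
pose del := fix del i : R := if i is j.+1 then
  Num.min (gap (sel (del j))) (del j / 2) else 1.
have del0 i : 0 < del i.
  elim: i => [|i IH] //=; rewrite lt_min (proj1 (Hgap _)) /=.
  by rewrite divr_gt0.
have delS i : del i.+1 <= del i / 2 by rewrite /= ge_min lexx orbT.
have del_mono i j : (i <= j)%N -> del j <= del i.
  move/subnKC <-; elim: (j - i)%N => [|t IH]; first by rewrite addn0.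
  rewrite addnS; apply: le_trans IH; apply: le_trans (delS _) _.
  by have := del0 (i + t)%N; lra.
have delX i : del i * 2 ^+ i <= 1.
  elim: i => [|i IH]; first by rewrite expr0 mulr1.
  apply: le_trans IH; rewrite exprS mulrA ler_wpM2r ?exprn_ge0 //.
  by have := delS i; lra.
have P i := Hsel _ (del0 i).
have dist i j : (i < j)%N -> ~ near1 (sel (del i)) (del j).
  move=> ij near; have [_] := Hgap (sel (del i)); apply; first exact: (P i).1.
  apply: near1_le near; apply: le_trans (del_mono _ _ ij) _.
  by rewrite /= ge_min lexx.
exists (fun i => sel (del i)); split.
- by move=> i; have [[]] := P i.
- move=> i j ij pe; have [lt|lt|//] := ltngtP i j.
    apply: (dist _ _ lt); apply: near1_proj_eq pe _; exact: (P j).2.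
  apply: (dist _ _ lt); apply: near1_proj_eq (P i).2.
  case: pe => mu [m1 ->]; exists mu^-1; rewrite normfV m1 invr1; split=> //.
  by rewrite scalerA mulVf ?scale1r // -normr_eq0 m1 oner_neq0.
- by move=> i; have [/chain_fixer_finite[]] := P i.
- by move=> i; have [/chain_fixer_finite[]] := P i.
move=> eps eps0; have [N HN] := @exp_unbounded 2 eps 1 (ltr1n _ _) eps0.
exists N => k Nk; apply: near1_pu_near; apply: near1_le (P k).2.
apply: le_trans (del_mono _ _ Nk) _.
have p0 : 0 < 2 ^+ N :> R by rewrite exprn_gt0.
rewrite -(ler_pM2r p0); apply: le_trans (delX N) _; rewrite mulrC; exact: ltW.
Qed.

(** If [g *m u] were on the null line of [w], [herm (g *m u) w] would vanish, although for [g] near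
    1 it is close to a unit multiple of [herm u w]. *)
Lemma near1_not_swap u w : herm u w != 0 ->
  exists2 d, 0 < d & forall g, near1 g d -> herm w w = 0 -> ~ proportional w (g *m u).
Proof.
move=> uw; pose N := nrm u * nrm w + 1.
have N0 : 0 < N by apply: ltr_wpDl; rewrite ?mulr_ge0 ?nrm_ge0.
exists (cabs (herm u w) / N); first by rewrite divr_gt0 // cabs_gt0.
move=> g [lam l1 near] qw [c e].
have : herm ((lam *: g - 1%:M) *m u) w = - herm u w.
  by rewrite mulmxBl -scalemxAl e mul1mx hermDl hermNl !hermZl qw !mulr0 add0r.
move/(congr1 cabs); rewrite cabsN => E.
have := cabs_herm ((lam *: g - 1%:M) *m u) w; rewrite E; apply/negP; rewrite -ltNge.
apply: le_lt_trans (ler_wpM2r (nrm_ge0 _) (nrmM _ _)) _.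
move: near; rewrite ltr_pdivlMr //; apply: le_lt_trans.
by rewrite -mulrA ler_wpM2l ?nrm_ge0 // /N lerDl.
Qed.

Lemma conj_quotient_near g d : inU g -> d <= zradius n -> near1 g d ->
  nrm (g *m h *m invmx g) <= n.+2%:R ^+ 2 * nrm h /\
  nrm (g *m h *m invmx g *m invmx h - 1%:M) <= 2 * n.+2%:R * nrm h ^+ 2 * d.
Proof.
move=> gU dz [lam l1 near]; have hU := ax_U ax.
have lam0 : lam != 0 by rewrite -cabs_gt0 l1.
have ng : nrm g <= n.+2%:R.
  have := nrm_near1 (ltW (lt_le_trans near dz)).
  by rewrite nrmZ l1 mul1r.
split.
  apply: le_trans (nrmM _ _) _; rewrite nrm_invmx //.
  apply: le_trans (ler_wpM2r (nrm_ge0 _) (nrmM _ _)) _.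
  rewrite mulrAC expr2 ler_wpM2r ?nrm_ge0 //.
  by apply: ler_pM; rewrite ?nrm_ge0.
set e := lam *: g - 1%:M in near.
(* Subtracting the identity from [lam *: g] does not change the commutator with [h], so the estimate
   is linear in [d]. *)
have eg : g *m h - h *m g = lam^-1 *: (e *m h - h *m e).
  rewrite /e mulmxBl mulmxBr mul1mx mulmx1 -scalemxAl -scalemxAr opprB addrA subrK.
  by rewrite -scalerBr scalerA mulVf // scale1r.
have -> : g *m h *m invmx g *m invmx h - 1%:M =
   (g *m h - h *m g) *m (invmx g *m invmx h).
  rewrite mulmxBl; congr (_ - _); first by rewrite !mulmxA.
  by rewrite mulmxA -(mulmxA h) mulmxV ?inU_unit // mulmx1 mulmxV ?inU_unit.
rewrite eg -scalemxAl nrmZ cabsV l1 invr1 mul1r.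
apply: le_trans (nrmM _ _) _.
apply: le_trans (ler_pM (nrm_ge0 _) (nrm_ge0 _) (nrmB _ _) (nrmM _ _)) _.
rewrite !nrm_invmx //.
apply: le_trans (_ : (d * nrm h + nrm h * d) * (n.+2%:R * nrm h) <= _); last first.
  by rewrite le_eqVlt; apply/orP; left; apply/eqP; ring.
have d0 := le_trans (nrm_ge0 _) (ltW near).
apply: ler_pM; rewrite ?addr_ge0 ?mulr_ge0 ?nrm_ge0 //.
  by apply: lerD; apply: le_trans (nrmM _ _) _;
    [rewrite ler_wpM2r ?nrm_ge0 // ltW|rewrite ler_wpM2l ?nrm_ge0 // ltW].
by rewrite ler_wpM2r ?nrm_ge0.
Qed.

Lemma near1_permutes_axis : conditionA (stab2 G x y) ->
  exists2 d, 0 < d & forall g, G g -> near1 g d ->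
    (proportional x (g *m x) \/ proportional y (g *m x)) /\
    (proportional x (g *m y) \/ proportional y (g *m y)).
Proof.
move=> cA; have [dA dA0 HA] := conditionA_gap cA.
have [G1 GU GM GV] := hG; have [hU nx ny xy hx hy hl] := ax.
have [z0 z1 _ _] := zradius_bounds n.
have h1 : 1 <= nrm h := nrm_inU_ge1 hU.
have N1 : 1 <= n.+2%:R :> R by rewrite ler1n.
(* A common bound on the norms of [h] and of its conjugate [f], so that one threshold serves both
   axes. *)
pose B := n.+2%:R ^+ 2 * nrm h.
have hB : nrm h <= B by rewrite /B ler_peMl ?nrm_ge0 // exprn_ege1.
have B1 : 1 <= B by apply: le_trans hB.
pose BB := B ^+ (2 * n.+2); have BB1 : 1 <= BB by apply: exprn_ege1.
(* The first term lets [small_central_fixes_axis] apply, the second puts [k] inside the gap of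
   Condition A. *)
pose th := Num.min (zradius n / BB) (dA / 2).
have th0 : 0 < th by rewrite lt_min !divr_gt0 //; apply: lt_le_trans BB1.
pose c := 2 * n.+2%:R * nrm h ^+ 2.
have c0 : 0 < c by rewrite !mulr_gt0 ?exprn_gt0 //; apply: lt_le_trans h1.
exists (Num.min (zradius n) (th / c)); first by rewrite lt_min z0 divr_gt0.
move=> g Gg near; have gU := GU _ Gg.
have [fB kth] := conj_quotient_near gU (minr_le_l _ _) near.
pose f := g *m h *m invmx g; rewrite -/f in fB kth.
have Gf : G f by apply: (GM _ _ (GM _ _ Gg hh) (GV _ Gg)).
have axf : axial f (g *m x) (g *m y) l m by apply: axial_conj.
have {}kth : nrm (f *m invmx h - 1%:M) <= th.
  apply: le_trans kth _; rewrite -/c mulrC -ler_pdivlMr //.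
  by rewrite ge_min lexx orbT.
have Sg : PUsubgroup (gen2 h f) by apply: gen2_subgroup => //; apply: GU.
have Sd : pu_discrete (gen2 h f).
  by apply: gen2_discrete => //; [exact: axial_loxodromic ax | exact: axial_loxodromic axf].
have Sh : gen2 h f h by apply: gen2_A.
have Sf : gen2 h f f by apply: gen2_B.
have Sk' : gen2 h f (f *m invmx h) by apply: gen2_mul => //; apply: gen2_inv.
have [idk|nidk] := classic (is_id (f *m invmx h)).
  (* Here [f] and [h] agree in PU(1,n) and so have the same fixed points. *)
  have hf p : null_vec p -> fixes f p -> proportional x p \/ proportional y p.
    move=> np fp; apply: (axial_fix ax (null_closure np)).
    have kU : inU (f *m invmx h) by apply: inUM; [apply: GU | apply: inUV].
    have -> : h = invmx (f *m invmx h) *m f.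
      have e := mulmxKV (inU_unit hU) f.
      by rewrite -{2}e mulKmx ?inU_unit.
    by apply: fixesM => //; apply: fixesV; [|case: np|exact: fixes_id].
  split; apply: hf; try exact: nullU.
    by exists l; exact: ax_hx axf.
  by exists m; exact: ax_hy axf.
have thz : th <= zradius n.
  apply: le_trans (_ : zradius n / BB <= _); first by rewrite ge_min lexx.
  rewrite ler_pdivrMr ?ler_peMr //; [exact: ltW | exact: lt_le_trans BB1].
have [k [Sk nid knear central]] := exists_small_central Sg Sd Sk' nidk (le_trans kth thz).
have kth' : nrm (k - 1%:M) <= th := le_trans knear kth.
have small X : inU X -> nrm X <= B -> nrm X ^+ (2 * n.+2) * nrm (k - 1%:M) <= zradius n.
  move=> XU XB; apply: le_trans (_ : BB * th <= _).
    apply: ler_pM; rewrite ?exprn_ge0 ?nrm_ge0 //.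
    by rewrite lerXn2r // nnegrE ?nrm_ge0 //; apply: le_trans B1.
  rewrite mulrC -ler_pdivlMr; last exact: lt_le_trans BB1.
  by rewrite ge_min lexx.
have [kx ky] := small_central_fixes_axis Sg Sd Sh Sk ax (small _ hU hB) central.
have [kgx kgy] := small_central_fixes_axis Sg Sd Sf Sk axf (small _ (GU _ Gf) fB) central.
have Gk : G k := gen2_sub hG hh Gf Sk.
have knear1 : near1 k dA.
  exists 1; first exact: cabs1.
  rewrite scale1r; apply: le_lt_trans kth' _.
  by apply: le_lt_trans (_ : dA / 2 < _); [rewrite ge_min lexx orbT | lra].
(* If [g *m x] or [g *m y] were off the axis of [h], it would be a third fixed point of [k] and make
   [k] trivial. *)
have key p : null_vec p -> fixes k p -> proportional x p \/ proportional y p.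
  move=> np fp; apply: NNPP => H; apply: nid; apply: HA => //.
  by exists p; split=> // H'; apply: H; [left|right].
by split; apply: key => //; apply: nullU.
Qed.

Lemma near1_fixes_axis : conditionA (stab2 G x y) ->
  exists2 d, 0 < d & forall g, G g -> near1 g d -> fixes g x /\ fixes g y.
Proof.
move=> cA; have [d1 d10 H1] := near1_permutes_axis cA.
have [d2 d20 H2] := near1_not_swap (axial_herm ax).
have [d3 d30 H3] := near1_not_swap (axial_herm (axial_sym ax)).
have [hU [_ qx] [_ qy] _ _ _ _] := ax.
exists (Num.min d1 (Num.min d2 d3)); first by rewrite !lt_min d10 d20.
move=> g Gg near.
have [gx gy] := H1 g Gg (near1_le (minr_le_l _ _) near).
split.
  case: gx => [[c e]|]; first by exists c.
  move=> yx; case: (H2 g) => //; apply: near1_le near.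
  by rewrite !ge_min lexx orbT.
case: gy => [xy|[c e]]; last by exists c.
case: (H3 g) => //; apply: near1_le near.
by rewrite !ge_min lexx !orbT.
Qed.

End Axis.

(** On the span, [A] squares to [a * b], so [x + s *: y] and [x - s *: y] are eigenvectors for the
    square roots [nu] and [- nu]. Their values of [qf] are nonzero and opposite, so one is
    positive. *)
Lemma swap_elliptic A x y a b : inU A -> null_vec x -> null_vec y -> ~ proportional x y ->
  A *m x = a *: y -> A *m y = b *: x -> ~ is_id A -> elliptic A.
Proof.
move=> AU nx ny xy ex ey nid; split=> //.
have [[x0 qx] [y0 qy]] := (nx, ny).
have a0 : a != 0.
  by apply: contraNneq (unitary_neq0 AU x0) => a0; rewrite ex a0 scale0r.
have b0 : b != 0.
  by apply: contraNneq (unitary_neq0 AU y0) => b0; rewrite ey b0 scale0r.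
pose nu : C := sqrtC (a * b); have nu2 : nu ^+ 2 = a * b by rewrite sqrtCK.
have nu0 : nu != 0 by rewrite -sqrf_eq0 nu2 mulf_neq0.
pose s := nu / b; pose c := herm x y.
have c0 : c != 0 by apply: closure_herm_neq0 => //; apply: null_closure.
have eig (t e : C) : e ^+ 2 = nu ^+ 2 -> t = e / b -> A *m (x + t *: y) = e *: (x + t *: y).
  move=> e2 ->; rewrite mulmxDr -scalemxAr ex ey scalerA mulfVK // scalerDr scalerA addrC.
  by congr (_ + _ *: _); rewrite mulrA -expr2 e2 nu2 mulfK.
have ep := eig s nu erefl erefl.
have em : A *m (x + (- s) *: y) = (- nu) *: (x + (- s) *: y).
  by apply: eig; rewrite ?sqrrN // mulNr.
have hE t r : herm (x + t *: y) (x + r *: y) = Num.conj r * c + t * Num.conj c.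
  by rewrite hermDl !hermDr !hermZl !hermZr qx qy (hermC x y) !mulr0 add0r addr0.
have orth : herm (x + s *: y) (x + (- s) *: y) = 0.
  (* Otherwise [eigen_herm] would give [- cabs nu ^+ 2 = 1]. *)
  apply/eqP/negPn/negP => hne; have := eigen_herm AU ep em hne.
  rewrite rmorphN mulrN mul_conj => /(congr1 (@complex.Re _)) /=.
  by have := sqr_ge0 (cabs nu); move: (cabs nu ^+ 2) => t; lra.
have sc : s * Num.conj c = Num.conj s * c.
  by move: orth; rewrite hE rmorphN mulNr addrC => /eqP; rewrite subr_eq0 => /eqP.
have qs : (qf (x + s *: y))%:C%C = 2 * (Num.conj s * c).
  by rewrite -herm_qf hE sc; ring.
have qm : (qf (x + (- s) *: y))%:C%C = - (qf (x + s *: y))%:C%C.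
  by rewrite qs -herm_qf hE rmorphN !mulNr sc; ring.
have qne : qf (x + s *: y) != 0.
  apply/eqP => q0; move: qs; rewrite q0 => /esym/eqP.
  by rewrite !mulf_eq0 conjC_eq0 (negbTE c0) orbF mulf_eq0 invr_eq0 (negbTE nu0)
    (negbTE b0) pnatr_eq0.
have qm' : qf (x + (- s) *: y) = - qf (x + s *: y).
  by apply: complexI; rewrite qm rmorphN.
have [q|q|q] := ltgtP 0 (qf (x + s *: y)).
- by exists (x + s *: y); split; [apply/pos_vecP | exists nu].
- exists (x + (- s) *: y); split; [apply/pos_vecP | by exists (- nu)].
  by rewrite qm' oppr_gt0.
- by rewrite -q eqxx in qne.
Qed.

(** Otherwise both elements given by [nonelementary] preserve the pair of points; a swap would make
    them elliptic, so both fix [x]. *)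
Lemma nonelementary_moves_axis G x y : PUsubgroup G -> nonelementary G ->
  null_vec x -> null_vec y -> ~ proportional x y ->
  exists A p, [/\ G A, p = A *m x \/ p = A *m y, ~ proportional x p & ~ proportional y p].
Proof.
move=> [G1 GU GM GV] [A [B [GA [GB [nA [nB [fA [fB no]]]]]]]] nx ny xy.
apply: NNPP => H.
have key X : G X -> ~ elliptic X -> ~ finite_order X -> fixes X x.
  move=> GX nX fX; have XU := GU _ GX.
  have pres p : p = X *m x \/ p = X *m y -> proportional x p \/ proportional y p.
    move=> ep; apply: NNPP => H'; apply: H; exists X, p; split=> //.
      by move=> h; apply: H'; left.
    by move=> h; apply: H'; right.
  have [[c e]|[a ea]] := pres _ (or_introl erefl); first by exists c.
  have [[b eb]|yy] := pres _ (or_intror erefl).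
    case: nX; apply: (swap_elliptic XU nx ny xy ea eb) => idX.
    by apply: fX; exists 1%N; rewrite expr1.
  case: xy; apply: (propU XU); apply: prop_trans yy; apply: prop_sym; last by exists a.
  by apply: unitary_neq0; case: nx.
by apply: no; exists x; do !split; try apply: key; case: nx.
Qed.

Lemma near1_discrete G d : PUsubgroup G -> 0 < d ->
  (forall g, G g -> near1 g d -> is_id g) -> pu_discrete G.
Proof.
move=> [G1 GU GM GV] d0 H A GA; have AU := GU _ GA.
have [N eN] : exists N : R, N = (n.+1 * n.+1)%:R * nrm A by eexists.
have A1 := nrm_inU_ge1 AU.
have N0 : 0 < N by rewrite eN mulr_gt0 ?ltr0n ?muln_gt0 //; apply: lt_le_trans A1.
(* [N] pays for passing from entries to [nrm] and for multiplying by [invmx A]; the 2 gives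
   strictness. *)
exists (d / (2 * N)); first by rewrite divr_gt0 // mulr_gt0.
move=> B GB [lam [/norm1_cabs l1 near]]; have lam0 : lam != 0 by rewrite -cabs_gt0 l1.
have nAB : nrm (lam *: A - B) <= (n.+1 * n.+1)%:R * (d / (2 * N)).
  apply: nrm_le_entry => i j; have := near i j; rewrite cabsE ltcR !mxE.
  exact: ltW.
have /is_idP[mu m1 e] : is_id (invmx A *m B).
  apply: H; first by apply: GM => //; apply: GV.
  exists lam^-1; first by rewrite cabsV l1 invr1.
  have -> : lam^-1 *: (invmx A *m B) - 1%:M = - lam^-1 *: (invmx A *m (lam *: A - B)).
    rewrite mulmxBr -scalemxAr mulVmx ?inU_unit // scalerBr !scaleNr scalerA mulVf //.
    by rewrite scale1r opprK addrC.
  rewrite nrmZ cabsN cabsV l1 invr1 mul1r; apply: le_lt_trans (nrmM _ _) _.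
  rewrite nrm_invmx //; apply: le_lt_trans (ler_wpM2l (nrm_ge0 _) nAB) _.
  rewrite mulrCA mulrA -eN.
  have -> : N * (d / (2 * N)) = d / 2 by field; rewrite gt_eqF.
  by lra.
exists mu; split=> //; rewrite -[B]mul1mx -(mulmxV (inU_unit AU)) -mulmxA e.
by rewrite mul_mx_scalar.
Qed.

Lemma near1_conj A g d : inU A -> near1 g d -> near1 (invmx A *m g *m A) (nrm A ^+ 2 * d).
Proof.
move=> AU [lam l1 near]; exists lam => //.
have -> : lam *: (invmx A *m g *m A) - 1%:M = invmx A *m (lam *: g - 1%:M) *m A.
  by rewrite mulmxBr mulmxBl mulmx1 mulVmx ?inU_unit // -scalemxAr -scalemxAl.
have A1 := nrm_inU_ge1 AU; have A0 : 0 < nrm A by apply: lt_le_trans A1.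
apply: le_lt_trans (nrmM _ _) _.
apply: le_lt_trans (ler_wpM2r (nrm_ge0 _) (nrmM _ _)) _.
by rewrite nrm_invmx // mulrAC -expr2 ltr_pM2l // exprn_gt0.
Qed.

End Criterion.

Theorem theorem3p4 (n : nat) (hn : (1 <= n)%N)
  (G : 'M[C]_(n.+1) -> Prop) (hG : PUsubgroup G) (hne : nonelementary G)
  (h : 'M[C]_(n.+1)) (x0 y0 : 'cV[C]_(n.+1))
  (hh : G h) (hlox : loxodromic h)
  (hx0 : null_vec x0) (hy0 : null_vec y0)
  (hfx : fixes h x0) (hfy : fixes h y0) (hxy : ~ proportional x0 y0) :
  pu_discrete G <->
  (conditionA (stab2 G x0 y0) /\
   forall A B, G A -> G B -> loxodromic A -> loxodromic B ->
     pu_discrete (gen2 A B)).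
Proof.
have [G1 GU GM GV] := hG; split.
  move=> disc; split.
    (* In a discrete group a sequence tending to the identity is eventually trivial, so two of its
       terms coincide. *)
    move=> [g [gG gdist _ _ gcvg]].
    have [e e0 H] := disc _ G1; have [N HN] := gcvg _ e0.
    have idg k : (N <= k)%N -> proj_eq 1%:M (g k).
      move=> Nk; have [Gk _ _] := gG k; apply: H => //.
      exact: pu_near_sym (HN k Nk).
    have [[a [a1 ea]] [b [b1 eb]]] := (idg N (leqnn N), idg N.+1 (leqnSn N)).
    apply: (gdist N N.+1) => [/eqP|]; first by rewrite ltn_eqF.
    have a0 : a != 0 by rewrite -normr_eq0 a1 oner_neq0.
    exists (b / a); rewrite normrM normfV a1 b1 divr1; split=> //.
    by rewrite ea scalerA mulfVK.
  move=> A B GA GB _ _ X SX; have [e e0 H] := disc X (gen2_sub hG GA GB SX).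
  exists e => // Y SY; apply: H; exact: gen2_sub hG GA GB SY.
move=> [cA gd]; have [l [m ax]] := loxodromic_axial (GU _ hh) hlox hx0 hy0 hfx hfy hxy.
have [dA dA0 HA] := conditionA_gap hG hh ax gd cA.
have [d1 d10 H1] := near1_fixes_axis hG hh ax gd cA.
have [A [p [GA pA xp yp]]] := nonelementary_moves_axis hG hne hx0 hy0 hxy.
have AU := GU _ GA; have A1 := nrm_inU_ge1 AU.
have A2 : 0 < nrm A ^+ 2 by rewrite exprn_gt0 // (lt_le_trans ltr01).
(* The three radii serve the gap of Condition A, [g] itself and its conjugate by [A]. *)
pose d := Num.min dA (Num.min d1 (d1 / nrm A ^+ 2)).
apply: (@near1_discrete _ _ d) => //; first by rewrite !lt_min dA0 d10 divr_gt0.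
move=> g Gg near.
have [gx gy] : fixes g x0 /\ fixes g y0.
  by apply: H1 => //; apply: near1_le near; rewrite !ge_min lexx orbT.
apply: HA; [by [] | | by apply: near1_le near; rewrite ge_min lexx].
(* As the conjugate fixes [x0] and [y0], [g] fixes their images under [A], one of which is [p]. *)
have [cx cy] : fixes (invmx A *m g *m A) x0 /\ fixes (invmx A *m g *m A) y0.
  apply: H1; first exact: GM _ _ (GM _ _ (GV _ GA) Gg) GA.
  apply: near1_le (near1_conj AU near); rewrite mulrC -ler_pdivlMr //.
  by rewrite !ge_min lexx !orbT.
have back : g = A *m (invmx A *m g *m A) *m invmx A.
  by rewrite !mulmxA mulmxV ?inU_unit // mul1mx -mulmxA mulmxV ?inU_unit // mulmx1.
exists p; split=> //.
  by case: pA => ->; apply: nullU.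
by case: pA => ->; rewrite back; apply: fixes_conj.
Qed.
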